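(* Let $\Omega\subset\mathbb{R}^4$ be a domain, let $k\geqslant 1$, and let $f,g$ be $k$-regular functions on $\Omega$. Then $L_0f+L_1g$ is a $(k-1)$-regular function on $\Omega$. In particular: (i) if $f,g$ are $2$-regular on $\Omega$, then the function $\tau(L_0f+L_1g)$ is quaternionic regular on $\Omega$; (ii) if $f,g$ are $1$-regular on $\Omega$, then $L_0f+L_1g$ is harmonic on $\Omega$.
   Context: Coordinates on $\mathbb{R}^4$ are $(x_0,x_1,x_2,x_3)$. $\mathbb{H}$ denotes the quaternions with units $\mathbf{i},\mathbf{j},\mathbf{k}$, $\mathbf{i}^2=\mathbf{j}^2=\mathbf{k}^2=\mathbf{i}\mathbf{j}\mathbf{k}=-1$; $\mathbb{C}$ is embedded in $\mathbb{H}$ by identifying $i$ with $\mathbf{i}$. A $C^1$ function $F:\Omega\to\mathbb{H}$ is quaternionic regular if $DF=0$, where $D=\partial_{x_0}+\mathbf{i}\,\partial_{x_1}+\mathbf{j}\,\partial_{x_2}+\mathbf{k}\,\partial_{x_3}$ (units multiply on the left). Symmetric powers. For $k\geqslant1$, $\odot^k\mathbb{C}^2\subset\otimes^k\mathbb{C}^2$ is the space of arrays $(f_{A_0'\cdots A_{k-1}'})$, $A_0',\dots,A_{k-1}'\in\{0',1'\}$, of complex numbers invariant under all permutations of the indices; $\odot^0\mathbb{C}^2=\mathbb{C}$. Elements of $\mathbb{C}^2\otimes\odot^k\mathbb{C}^2$ are arrays $(f_{AA_0'\cdots A_{k-1}'})$, $A\in\{0,1\}$, symmetric in the primed indices. Derivatives: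 $\nabla_0^{0'}=-\partial_{x_2}-i\partial_{x_3}$, $\nabla_0^{1'}=-\partial_{x_0}-i\partial_{x_1}$, $\nabla_1^{0'}=\partial_{x_0}-i\partial_{x_1}$, $\nabla_1^{1'}=-\partial_{x_2}+i\partial_{x_3}$. $k$-Cauchy-Fueter operator: for $k\geqslant1$, $\mathscr{D}^{(k)}$ maps functions with values in $\odot^k\mathbb{C}^2$ to functions with values in $\mathbb{C}^2\otimes\odot^{k-1}\mathbb{C}^2$ by $(\mathscr{D}^{(k)}f)_{AA_0'\cdots A_{k-2}'}=\sum_{A'=0',1'}\nabla_A^{A'}f_{A'A_0'\cdots A_{k-2}'}$ (for $k=1$: $(\mathscr{D}^{(1)}f)_A=\sum_{A'}\nabla_A^{A'}f_{A'}$). A function $f\in C^1(\Omega,\odot^k\mathbb{C}^2)$ is $k$-regular on $\Omega$ if $\mathscr{D}^{(k)}f=0$ on $\Omega$. A complex-valued function is $0$-regular if it is harmonic. Functions $z_A^{A'}$: $z_0^{0'}=x_2+x_3i$, $z_0^{1'}=x_0+x_1i$, $z_1^{0'}=-x_0+x_1i$, $z_1^{1'}=x_2-x_3i$. Operators $L_0,L_1$: for $j=0,1$ and $f$ with values in $\odot^k\mathbb{C}^2$, $k\geqslant1$, $L_jf$ is the $\odot^{k-1}\mathbb{C}^2$-valued function $(L_jf)_{A_0'\cdots A_{k-2}'}=z_j^{0'}f_{0'A_0'\cdots A_{k-2}'}+z_j^{1'}f_{1'A_0'\cdots A_{k-2}'}$ (for $k=1$: $L_jf=z_j^{0'}f_{0'}+z_j^{1'}f_{1'}$).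 For a $\mathbb{C}^2$-valued function $u=(u_0,u_1)$ (with $u_0=u_{0'}$, $u_1=u_{1'}$), $\tau(u):=\mathbf{j}(u_0+\mathbf{j}u_1)$, an $\mathbb{H}$-valued function. *)

(* Defs.v *)
From HB Require Import structures.
From mathcomp Require Import all_boot all_order all_fingroup all_algebra.
From mathcomp Require Import complex ring.
From mathcomp Require Import all_classical all_reals all_analysis.

Set Implicit Arguments.
Unset Strict Implicit.
Unset Printing Implicit Defensive.

Import Order.TTheory GRing.Theory Num.Theory.
Import numFieldNormedType.Exports.

Local Open Scope classical_set_scope.
Local Open Scope ring_scope.

(* Quat a b c d is a + b i + c j + d k. *)
Record quat (R : Type) := Quat { q0 : R; q1 : R; q2 : R; q3 : R }.

Section QuatRing.
Variable R : realType.
Local Notation H := (quat R).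

Definition quat_to_tuple (a : H) : R * R * R * R := (q0 a, q1 a, q2 a, q3 a).
Definition tuple_to_quat (t : R * R * R * R) : H :=
  Quat t.1.1.1 t.1.1.2 t.1.2 t.2.

Lemma quat_to_tupleK : cancel quat_to_tuple tuple_to_quat.
Proof. by case. Qed.

HB.instance Definition _ := Choice.copy H (can_type quat_to_tupleK).

Definition qzero : H := Quat 0 0 0 0.
Definition qone : H := Quat 1 0 0 0.
Definition qopp (a : H) : H := Quat (- q0 a) (- q1 a) (- q2 a) (- q3 a).
Definition qadd (a b : H) : H :=
  Quat (q0 a + q0 b) (q1 a + q1 b) (q2 a + q2 b) (q3 a + q3 b).
Definition qmul (a b : H) : H :=
  Quat (q0 a * q0 b - q1 a * q1 b - q2 a * q2 b - q3 a * q3 b)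
       (q0 a * q1 b + q1 a * q0 b + q2 a * q3 b - q3 a * q2 b)
       (q0 a * q2 b - q1 a * q3 b + q2 a * q0 b + q3 a * q1 b)
       (q0 a * q3 b + q1 a * q2 b - q2 a * q1 b + q3 a * q0 b).

Fact qaddA : associative qadd.
Proof. by move=> a b c; congr Quat; rewrite addrA. Qed.
Fact qaddC : commutative qadd.
Proof. by move=> a b; congr Quat; rewrite addrC. Qed.
Fact qadd0 : left_id qzero qadd.
Proof. by case=> *; congr Quat; rewrite add0r. Qed.
Fact qaddN : left_inverse qzero qopp qadd.
Proof. by move=> a; congr Quat; rewrite addNr. Qed.

HB.instance Definition _ := GRing.isZmodule.Build H qaddA qaddC qadd0 qaddN.

Fact qmulA : associative qmul.
Proof. by move=> a b c; congr Quat => /=; ring. Qed.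
Fact qmul1l : left_id qone qmul.
Proof. by case=> *; congr Quat => /=; ring. Qed.
Fact qmul1r : right_id qone qmul.
Proof. by case=> *; congr Quat => /=; ring. Qed.
Fact qmulDl : left_distributive qmul qadd.
Proof. by move=> a b c; congr Quat => /=; ring. Qed.
Fact qmulDr : right_distributive qmul qadd.
Proof. by move=> a b c; congr Quat => /=; ring. Qed.
Fact qone_neq0 : qone != 0 :> H.
Proof. by apply/eqP => -[] /eqP; rewrite oner_eq0. Qed.

HB.instance Definition _ := GRing.Zmodule_isNzRing.Build H
  qmulA qmul1l qmul1r qmulDl qmulDr qone_neq0.

Definition qi : H := Quat 0 1 0 0.
Definition qj : H := Quat 0 0 1 0.
Definition qk : H := Quat 0 0 0 1.

Lemma qii : qi * qi = -1.
Proof. by congr Quat => /=; ring. Qed.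
Lemma qjj : qj * qj = -1.
Proof. by congr Quat => /=; ring. Qed.
Lemma qkk : qk * qk = -1.
Proof. by congr Quat => /=; ring. Qed.
Lemma qijk : qi * qj * qk = -1.
Proof. by congr Quat => /=; ring. Qed.

Definition quat_of_complex (c : R[i]) : H :=
  Quat (complex.Re c) (complex.Im c) 0 0.

End QuatRing.

Arguments qi {R}.
Arguments qj {R}.
Arguments qk {R}.

Section KCauchyFueter.
Variable R : realType.
Local Notation C := R[i].
Local Notation H := (quat R).
Local Notation R4 := 'rV[R]_4.
Local Notation "''i'" := ('i%C : C).

Definition is_domain (Omega : set R4) : Prop :=
  [/\ open Omega, connected Omega & Omega !=set0].

(* Functions on Omega are represented by total functions on R^4; as Omega is
   open, the predicates below only depend on the values on Omega. *)

Definition partial (i : 'I_4) (f : R4 -> R) : R4 -> R :=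
  'D_(delta_mx 0 i : R4) f.

Fixpoint is_Cn (n : nat) (Omega : set R4) (f : R4 -> R) : Prop :=
  (forall x, Omega x -> {for x, continuous f}) /\
  if n is m.+1 then
    forall i : 'I_4,
      (forall x, Omega x -> derivable f x (delta_mx 0 i : R4)) /\
      is_Cn m Omega (partial i f)
  else True.

Definition is_CnC (n : nat) (Omega : set R4) (f : R4 -> C) : Prop :=
  is_Cn n Omega (fun x => complex.Re (f x)) /\
  is_Cn n Omega (fun x => complex.Im (f x)).

Definition partialC (i : 'I_4) (f : R4 -> C) : R4 -> C := fun x =>
  (partial i (fun y => complex.Re (f y)) x +i*
   partial i (fun y => complex.Im (f y)) x)%C.

Definition is_harmonic (Omega : set R4) (f : R4 -> C) : Prop :=
  is_CnC 2 Omega f /\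
  forall x, Omega x -> \sum_(i < 4) partialC i (partialC i f) x = 0.

Definition is_CnH (n : nat) (Omega : set R4) (F : R4 -> H) : Prop :=
  [/\ is_Cn n Omega (fun x => q0 (F x)), is_Cn n Omega (fun x => q1 (F x)),
      is_Cn n Omega (fun x => q2 (F x)) & is_Cn n Omega (fun x => q3 (F x))].

Definition partialH (i : 'I_4) (F : R4 -> H) : R4 -> H := fun x =>
  Quat (partial i (fun y => q0 (F y)) x) (partial i (fun y => q1 (F y)) x)
       (partial i (fun y => q2 (F y)) x) (partial i (fun y => q3 (F y)) x).

Definition fueter (F : R4 -> H) : R4 -> H := fun x =>
  partialH 0 F x + qi * partialH 1 F x + qj * partialH 2 F x
  + qk * partialH 3 F x.

Definition quat_regular (Omega : set R4) (F : R4 -> H) : Prop :=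
  is_CnH 1 Omega F /\ forall x, Omega x -> fueter F x = 0.

(* Arrays with k indices in {0,1}; both the unprimed indices A and the primed
   indices A' are elements of 'I_2. For k = 0 the only entry is at [tuple],
   so that array 0 is a copy of C. *)
Definition array (k : nat) := {ffun k.-tuple 'I_2 -> C}.

Definition sym_array (k : nat) (a : array k) : Prop :=
  forall (s : 'S_k) (t : k.-tuple 'I_2),
    a [tuple tnth t (s i) | i < k] = a t.

Definition nabla (A A' : 'I_2) (f : R4 -> C) : R4 -> C := fun x =>
  if A == 0 then
    if A' == 0 then - partialC 2 f x - 'i * partialC 3 f x
    else - partialC 0 f x - 'i * partialC 1 f x
  else
    if A' == 0 then partialC 0 f x - 'i * partialC 1 f x
    else - partialC 2 f x + 'i * partialC 3 f x.

Definition zfun (A A' : 'I_2) (x : R4) : C :=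
  if A == 0 then
    if A' == 0 then (x 0 2)%:C%C + (x 0 3)%:C%C * 'i
    else (x 0 0)%:C%C + (x 0 1)%:C%C * 'i
  else
    if A' == 0 then - (x 0 0)%:C%C + (x 0 1)%:C%C * 'i
    else (x 0 2)%:C%C - (x 0 3)%:C%C * 'i.

Definition cauchy_fueter (k : nat) (f : R4 -> array k.+1) (A : 'I_2) :
    R4 -> array k := fun x =>
  [ffun t : k.-tuple 'I_2 =>
    \sum_(A' < 2) nabla A A' (fun y => f y [tuple of A' :: t]) x].

Definition k_regular (k : nat) (Omega : set R4) : (R4 -> array k) -> Prop :=
  match k with
  | 0 => fun f => is_harmonic Omega (fun x => f x [tuple])
  | k'.+1 => fun f =>
      [/\ forall x, Omega x -> sym_array (f x),
          forall t, is_CnC 1 Omega (fun x => f x t)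
        & forall (A : 'I_2) x, Omega x -> cauchy_fueter f A x = 0]
  end.

Definition Lop (k : nat) (j : 'I_2) (f : R4 -> array k.+1) : R4 -> array k :=
  fun x => [ffun t : k.-tuple 'I_2 =>
    \sum_(A' < 2) zfun j A' x * f x [tuple of A' :: t]].

Definition tau (u : R4 -> array 1) : R4 -> H := fun x =>
  qj * (quat_of_complex (u x [tuple 0]) + qj * quat_of_complex (u x [tuple 1])).

End KCauchyFueter.

(* Main.v *)
Require Import Defs.
From HB Require Import structures.
From mathcomp Require Import all_boot all_order all_fingroup all_algebra.
From mathcomp Require Import complex ring lra.
From mathcomp Require Import all_classical all_reals all_analysis.

Import Order.TTheory GRing.Theory Num.Theory.
Import numFieldNormedType.Exports.

Local Open Scope classical_set_scope.
Local Open Scope ring_scope.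

Set Implicit Arguments.
Unset Strict Implicit.
Unset Printing Implicit Defensive.

(** The operator [D^(k)] of [L_j f] vanishes by the Leibniz rule: [z_j] satisfies
    [nabla_A^B z_j^A' = - nabla_A^A' z_j^B], while [f] is symmetric and killed by
    [D^(k+1)]. For [k = 1] the Laplacian of [L_j f] is
    [2 <grad z_j, grad f> + z_j Laplacian f], whose first term is a multiple of the
    equation [D^(1) f = 0]; the difficulty is that [f] is only assumed [C^1].

    That a [C^1] solution is [C^2] and harmonic follows from the maximum principle.
    The Steklov average of a solution over a cube is twice differentiable along the
    axes and harmonic, so comparing its odd part with a quadratic barrier on a half
    cube bounds [u (x + h e) - u (x - h e)] by [10 (sup |u|) h / D] on a cube of
    radius [D]; the bound survives the removal of the averaging. As difference
    quotients of solutions are solutions, three applications of this bound show that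
    the second difference quotients converge locally uniformly. *)

(** * Epsilon-delta forms of continuity and directional derivatives *)

Section EpsilonDelta.
Variable R : realType.
Local Notation R4 := 'rV[R]_4.

(** The obstacle: the Laplacian of a component [a] is [d_2 E1 + d_3 E2 + d_0 E3 - d_1 E4], with
    [E1], ..., [E4] the four real equations, and a C^1 solution does not allow these derivatives to
    be taken. Averaging along an axis gains one derivative along that axis, so averaging along all
    four axes gives every pure second derivative; a mixed one becomes an averaged difference
    quotient that is symmetric in its two directions, which stands in for Schwarz's theorem. The
    barrier argument uses pure second derivatives and the supremum of the function, never the size
    of its derivatives, so the estimate is uniform in the averaging step. Only the first component
    is ever estimated: multiplication by [-i] and the quaternionic structure of the system bring
    each of the others into first place. All this serves [k = 1]; for larger [k] a single derivative
    of [f] is enough. *)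

Definition evec (i : 'I_4) : R4 := delta_mx 0 i.

Lemma evecE i j : evec i 0 j = (j == i)%:R.
Proof. by rewrite /evec mxE eqxx. Qed.

(** The norm of [R4] is the sup norm, so the balls used throughout are cubes with faces parallel to
    the axes. *)
Lemma coord_le_norm (x : R4) i : `|x 0 i| <= `|x|.
Proof.
rewrite [X in _ <= X]/Num.norm /= mx_normrE.
exact: (le_bigmax_cond _ (fun ij : 'I_1 * 'I_4 => `|x ij.1 ij.2|) (j := (0, i))).
Qed.

Lemma norm_le_coord (x : R4) M : 0 <= M -> (forall i, `|x 0 i| <= M) -> `|x| <= M.
Proof.
move=> M0 H; rewrite [X in X <= _]/Num.norm /= mx_normrE.
by apply/bigmax_leP; split => // -[a b] _ /=; rewrite (ord1 a).
Qed.

Lemma norm_evec i : `|evec i| = 1.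
Proof.
apply/eqP; rewrite eq_le; apply/andP; split.
  by apply: norm_le_coord => // j; rewrite evecE; case: eqP => _; rewrite ?normr1 ?normr0.
by have := coord_le_norm (evec i) i; rewrite evecE eqxx normr1.
Qed.

Lemma norm_scale_evec (t : R) i : `|t *: evec i| = `|t|.
Proof. by rewrite normrZ norm_evec mulr1. Qed.

Lemma continuous_forP (V : normedModType R) (g : V -> R) (x : V) :
  {for x, continuous g} <->
  forall eta, 0 < eta -> exists2 del, 0 < del &
    forall y, `|y - x| < del -> `|g y - g x| <= eta.
Proof.
split=> [/cvgrPdist_le gc eta e0|H].
  have /nbhs_normP [d /= d0 Hd] := gc _ e0.
  exists d => // y yx; rewrite distrC; apply: Hd => /=.
  by rewrite /= distrC.
apply/cvgrPdist_le => eta e0; have [d d0 Hd] := H _ e0.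
apply/nbhs_normP; exists d => //= y /= yx.
by rewrite distrC; apply: Hd; rewrite distrC.
Qed.

Lemma is_deriveP (V : normedModType R) (g : V -> R) (x v : V) (d : R) :
  is_derive x v g d <->
  forall eta, 0 < eta -> exists2 del, 0 < del &
    forall t, t != 0 -> `|t| < del -> `|t^-1 * (g (x + t *: v) - g x) - d| <= eta.
Proof.
have -> : is_derive x v g d <->
    (fun h => h^-1 *: ((g \o shift x) (h *: v) - g x)) @ 0^' --> d.
  split=> [[gd <-] //|H].
  by apply: DeriveDef; [apply/cvg_ex; exists d|exact: cvg_lim].
split=> [/cvgrPdist_le H eta e0|H].
  have := H _ e0; rewrite /dnbhs /within /=.
  move/nbhs_normP => [del /= d0 Hd]; exists del => // t t0 td.
  have := Hd t; rewrite /ball_ /= sub0r normrN => /(_ td t0).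
  by rewrite distrC /= [x + _]addrC.
apply/cvgrPdist_le => eta e0; have [d' d0 Hd] := H _ e0.
apply/nbhs_normP; exists d' => //= t; rewrite /= sub0r normrN => td t0.
by rewrite distrC /= [_ + x]addrC; apply: Hd.
Qed.

Lemma is_derive_line (g : R4 -> R) (x v : R4) (s d : R) :
  is_derive (x + s *: v) v g d -> is_derive s (1:R) (fun t => g (x + t *: v)) d.
Proof.
move/is_deriveP => H; apply/is_deriveP => eta e0; have [del d0 Hd] := H _ e0.
exists del => // t t0 td; have := Hd t t0 td.
by rewrite -addrA -scalerDl /GRing.scale /= mulr1.
Qed.

Lemma is_derive_line_inv (g : R4 -> R) (x v : R4) (s d : R) :
  is_derive s (1:R) (fun t => g (x + t *: v)) d -> is_derive (x + s *: v) v g d.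
Proof.
move/is_deriveP => H; apply/is_deriveP => eta e0; have [del d0 Hd] := H _ e0.
exists del => // t t0 td; have := Hd t t0 td.
by rewrite -addrA -scalerDl /GRing.scale /= mulr1.
Qed.

(** Differentiability on a symmetric interval lets one statement serve increments of both signs; a
    negative [t] is reduced to a positive one by reflection. *)
Lemma MVT_R (f df : R -> R) (t : R) :
  (forall s : R, `|s| <= `|t| -> is_derive s (1:R) f (df s)) ->
  exists2 c, `|c| <= `|t| & f t - f 0 = t * df c.
Proof.
have main (h g : R -> R) (u : R) : 0 <= u ->
    (forall s : R, `|s| <= u -> is_derive s (1:R) h (g s)) ->
    exists2 c, `|c| <= u & h u - h 0 = u * g c.
  move=> u0 H.
  have [||c cu E] := @MVT_segment R h g 0 u u0.
  - move=> s; rewrite in_itv /= => /andP[/ltW s0 /ltW su]; apply: H.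
    by rewrite ger0_norm.
  - apply: derivable_within_continuous => s; rewrite in_itv /= => /andP[s0 su].
    by have [] := H s; rewrite ?ger0_norm.
  exists c; last by rewrite E subr0 mulrC.
  by move: cu; rewrite in_itv /= => /andP[c0 cu]; rewrite ger0_norm.
move=> H; have [t0|t0] := leP 0 t.
  rewrite (ger0_norm t0) in H *; exact: main.
have t0' : 0 <= - t by rewrite oppr_ge0 ltW.
have [s sh|c ch E] := main (fun s => f (- s)) (fun s => - df (- s)) (- t) t0'.
  have ft := H (- s); rewrite normrN (ltr0_norm t0) in ft.
  have /is_deriveP {}ft := ft sh.
  apply/is_deriveP => eta e0; have [del d0 Hd] := ft _ e0; exists del => // u u0 ud.
  have := Hd (- u); rewrite oppr_eq0 normrN => /(_ u0 ud).
  rewrite /GRing.scale /= !mulr1 opprD invrN.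
  by rewrite -[X in X <= _ -> _]normrN mulNr opprD !opprK.
exists (- c); first by rewrite normrN (ltr0_norm t0).
by move: E; rewrite opprK oppr0 mulrNN.
Qed.

Lemma MVT_line (g g' : R4 -> R) (x v : R4) (t : R) :
  (forall s : R, `|s| <= `|t| -> is_derive (x + s *: v) v g (g' (x + s *: v))) ->
  exists2 c, `|c| <= `|t| & g (x + t *: v) - g x = t * g' (x + c *: v).
Proof.
move=> H; have [s st|c ct E] := @MVT_R (fun s => g (x + s *: v)) (fun s => g' (x + s *: v)) t.
  by apply: is_derive_line; exact: H.
by exists c => //; rewrite -E scale0r addr0.
Qed.

End EpsilonDelta.

(** * A gradient estimate from the maximum principle *)

Section GradientEstimate.
Variable R : realType.
Local Notation R4 := 'rV[R]_4.
Local Notation evec := (@evec R).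

(** This is [t ^+ 2] times the discrete Laplacian with mesh [t]. *)
Definition second_diff (u : R4 -> R) (t : R) (y : R4) : R :=
  \sum_(i < 4) (u (y + t *: evec i) + u (y - t *: evec i) - 2 * u y).

(* A pointwise form of [Laplacian u = 0] that suffices for the maximum principle
   and is invariant under reflections without any chain rule. *)
Definition asymp_harmonic (u : R4 -> R) (y : R4) : Prop :=
  forall eta, 0 < eta -> exists2 del, 0 < del &
    forall t, 0 < t < del -> `|second_diff u t y| <= eta * t ^+ 2.

Let stepE (y : R4) (t : R) i j : (y + t *: evec i) 0 j = y 0 j + t * (j == i)%:R.
Proof. by rewrite !mxE eqxx. Qed.

Let reflect (n : 'I_4) (y : R4) : R4 := y - (2 * y 0 n) *: evec n.

Let reflectE n y j : reflect n y 0 j = if j == n then - y 0 n else y 0 j.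
Proof.
rewrite /reflect !mxE eqxx /= -[in LHS]/(_ == n).
by case: eqP => [->|_] /=; [ring|rewrite mulr0 subr0].
Qed.

Let norm_reflect n y : `|reflect n y| <= `|y|.
Proof.
apply: norm_le_coord => // j; rewrite reflectE.
by case: eqP => _; rewrite ?normrN; exact: coord_le_norm.
Qed.

Let reflect_step n (y : R4) i (t : R) :
  reflect n (y + t *: evec i) = reflect n y + (if i == n then - t else t) *: evec i.
Proof.
apply/rowP => j; rewrite stepE !reflectE !stepE.
have [->|ni] := eqVneq i n; last first.
  by case: eqP => [->|//]; rewrite ?eqxx ?(eq_sym n) ?(negbTE ni) !mulr0 !addr0.
by case: eqP => _; rewrite ?mulr1 ?opprD // !mulr0 !addr0.
Qed.

Let second_diff_reflect n (u : R4 -> R) t y :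
  second_diff (fun z => u (reflect n z)) t y = second_diff u t (reflect n y).
Proof.
apply: eq_bigr => i _; rewrite -scaleNr !reflect_step.
by case: ifP => _; rewrite !scaleNr ?opprK // [X in X - _]addrC.
Qed.

(** The sum of squares is at least [d ^+ 2] where [|y| = d], and the second term is nonnegative for
    [0 <= y_n <= d]. The Laplacian is [8 - 2 * 5 = -2]: 5 is the least integer that makes it
    negative. As the function is quadratic, its second differences are exact. *)
Let barrier n (d : R) (y : R4) : R := \sum_j y 0 j ^+ 2 + 5 * (y 0 n * (d - y 0 n)).

Let barrier_step n d (y : R4) i (t : R) :
  barrier n d (y + t *: evec i) = barrier n d y + 2 * t * y 0 i + t ^+ 2
   + (if i == n then 5 * (t * (d - 2 * y 0 n) - t ^+ 2) else 0).
Proof.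
rewrite /barrier (bigD1 i) //= [in RHS](bigD1 i) //=.
rewrite (eq_bigr (fun j => y 0 j ^+ 2)); last first.
  by move=> j /negbTE ji; rewrite stepE ji mulr0 addr0.
rewrite !stepE eqxx.
have [->|ni] := eqVneq i n; first by rewrite ?eqxx /=; ring.
by rewrite ?(eq_sym n) ?(negbTE ni) /=; ring.
Qed.

Let second_diff_barrier n d t y : second_diff (barrier n d) t y = - 2 * t ^+ 2.
Proof.
rewrite /second_diff.
under eq_bigr do rewrite -scaleNr !barrier_step.
rewrite (eq_bigr (fun i => 2 * t ^+ 2 + (if i == n then - (10 * t ^+ 2) else 0))).
  rewrite big_split /= sumr_const card_ord -big_mkcond /= big_pred1_eq.
  by rewrite -mulr_natl; ring.
by move=> i _; case: ifP => _; ring.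
Qed.

Let continuous_barrier n d (y : R4) : {for y, continuous (barrier n d)}.
Proof.
have cc i : {for y, continuous (fun z : R4 => z 0 i)} by exact: coord_continuous.
have sq : \sum_j z 0 j ^+ 2 @[z --> y] --> \sum_j y 0 j ^+ 2.
  by apply: cvg_big => [|i _]; [exact: add_continuous|exact: (cvgM (cc i) (cc i))].
have lin : 5 * (z 0 n * (d - z 0 n)) @[z --> y] --> 5 * (y 0 n * (d - y 0 n)).
  apply: cvgM; first exact: cvg_cst.
  apply: cvgM; first exact: cc.
  by apply: cvgB; [exact: cvg_cst|exact: cc].
exact: (cvgD sq lin).
Qed.

(* The odd part of [u] across the hyperplane [y_n = 0] is compared on the half
   cube with [M / d^2 * barrier], which has negative Laplacian and dominates it
   on the boundary. *)
Lemma odd_part_bound (u : R4 -> R) n (d M : R) : 0 < d -> 0 < M ->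
  (forall y : R4, `|y| <= d -> {for y, continuous u} /\ `|u y| <= M) ->
  (forall y : R4, `|y| < d -> asymp_harmonic u y) ->
  forall h : R, 0 <= h <= d ->
  u (h *: evec n) - u (- (h *: evec n)) <= 10 * M * h / d.
Proof.
move=> d0 M0 hu lapu h /andP[h0 hd]; rewrite leNgt; apply/negP => contra.
(* Scaled so that on the outer faces [c * barrier] is at least [c * d ^+ 2 = M], which bounds the
   odd part. *)
pose c := M / d ^+ 2.
have d20 : 0 < d ^+ 2 by rewrite exprn_gt0.
have c0 : 0 < c by rewrite divr_gt0.
have cd2 : c * d ^+ 2 = M by rewrite /c mulfVK // gt_eqF.
pose w y := (u y - u (reflect n y)) / 2 - c * barrier n d y.
pose K := [set y : R4 | `|y| <= d /\ 0 <= y 0 n].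
have nhe : `|h *: evec n| = h by rewrite norm_scale_evec ger0_norm.
have Khe : K (h *: evec n).
  by split; rewrite ?nhe // !mxE !eqxx mulr1.
(* The barrier at this point is [5 d h - 4 h ^+ 2], at most [5 d h]; together with the factor 1/2 in
   the odd part this produces the constant 10. *)
have whe : 0 < w (h *: evec n).
  rewrite /w subr_gt0.
  have -> : reflect n (h *: evec n) = - (h *: evec n).
    apply/rowP => j; rewrite reflectE !mxE !eqxx /=.
    by case: eqP => _ //=; rewrite ?mulr0 ?oppr0.
  have -> : barrier n d (h *: evec n) = h ^+ 2 + 5 * (h * (d - h)).
    rewrite -[h *: _]add0r barrier_step eqxx /barrier !mxE.
    rewrite big1 => [|j _]; last by rewrite mxE expr0n.
    ring.
  rewrite ltr_pdivlMr //; apply: le_lt_trans contra.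
  have -> : 10 * M * h / d = 10 * c * d * h.
    by rewrite -cd2; field; rewrite gt_eqF.
  rewrite -subr_ge0.
  have -> : 10 * c * d * h - c * (h ^+ 2 + 5 * (h * (d - h))) * 2 = 8 * (c * h ^+ 2) by ring.
  by rewrite mulr_ge0 // mulr_ge0 ?(ltW c0) // exprn_ge0.
have cK : compact K.
  apply: bounded_closed_compact.
    exists d; split; first exact: num_real.
    by move=> x dx y [yd _] /=; apply: le_trans yd (ltW dx).
  apply: closedI.
    apply: (@closed_comp _ _ (fun y : R4 => `|y|) [set x | x <= d]); last exact: closed_le.
    by move=> x _; exact: norm_continuous.
  apply: (@closed_comp _ _ (fun y : R4 => y 0 n) [set x | 0 <= x]); last exact: closed_ge.
  by move=> x _; exact: coord_continuous.
have cw : {within K, continuous w}.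
  apply: continuous_in_subspaceT => y; rewrite inE => -[yd _].
  have ry : `|reflect n y| <= d by apply: le_trans yd; exact: norm_reflect.
  have cu : u z @[z --> y] --> u y by case: (hu y yd).
  have cr : reflect n z @[z --> y] --> reflect n y.
    have cn : (z : R4) 0 n @[z --> y] --> y 0 n by exact: coord_continuous.
    have cn2 : 2 * z 0 n @[z --> y] --> 2 * y 0 n by exact: (cvgM (cvg_cst _) cn).
    have cn3 : (2 * z 0 n) *: evec n @[z --> y] --> (2 * y 0 n) *: evec n.
      exact: cvgZr_tmp.
    by apply: (@cvgB _ _ _ (nbhs y) _ id (fun z => (2 * z 0 n) *: evec n)).
  have cur : u (reflect n z) @[z --> y] --> u (reflect n y).
    by apply: (cvg_comp _ _ cr); case: (hu _ ry).
  have cb : barrier n d z @[z --> y] --> barrier n d y by exact: continuous_barrier.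
  exact: (cvgB (cvgM (cvgB cu cur) (cvg_cst _)) (cvgM (cvg_cst _) cb)).
(* The maximum of [w] is positive, whereas [w <= 0] on the boundary of [K]: on the outer faces by
   the choice of [c], on [y_n = 0] because the odd part vanishes there. Hence [p] is interior. *)
have [p] := EVT_max_rV (ex_intro _ _ Khe) cK cw.
rewrite inE => -[pd pn] maxp.
have wp : 0 < w p by apply: lt_le_trans whe _; apply: maxp; rewrite inE.
have rpd : `|reflect n p| <= d by apply: le_trans pd; exact: norm_reflect.
have pn_le : p 0 n <= d.
  exact: le_trans (ler_norm _) (le_trans (coord_le_norm p n) pd).
have bar0 : 0 <= 5 * (p 0 n * (d - p 0 n)).
  by rewrite !mulr_ge0 // subr_ge0.
have pd' : `|p| < d.
  rewrite lt_neqAle pd andbT; apply/negP => /eqP pdE.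
  move: wp; rewrite /w subr_gt0 ltNge => /negP; apply.
  apply: (@le_trans _ _ M).
    have [_ h1] := hu _ pd; have [_ h2] := hu _ rpd.
    rewrite ler_pdivrMr //; apply: le_trans (ler_norm _) _.
    apply: le_trans (ler_normB _ _) _.
    by rewrite mulr_natr mulr2n lerD.
  rewrite -[leLHS]cd2 ler_pM2l // /barrier.
  have p0 : p != 0 by rewrite -normr_gt0 pdE.
  have [[a j] /= pj] := @mx_norm_neq0 _ _ _ p (lt0r_neq0 (etrans (congr1 _ pdE) d0)).
  rewrite (ord1 a) in pj; rewrite -{1}pdE [`|p|]pj real_normK ?num_real //.
  rewrite (bigD1 j) //= -addrA lerDl addr_ge0 //.
  by apply: sumr_ge0 => i _; exact: sqr_ge0.
have pn0 : 0 < p 0 n.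
  rewrite lt_neqAle pn andbT eq_sym; apply/negP => /eqP pn0.
  move: wp; rewrite /w subr_gt0 ltNge => /negP; apply.
  have -> : reflect n p = p by rewrite /reflect pn0 mulr0 scale0r subr0.
  rewrite subrr mul0r mulr_ge0 ?(ltW c0) // /barrier addr_ge0 //.
  by apply: sumr_ge0 => i _; exact: sqr_ge0.
have rpd' : `|reflect n p| < d by apply: le_lt_trans pd'; exact: norm_reflect.
(* With this tolerance the two errors lower the second difference of [w] by at most [c t^2 / 2],
   while the barrier contributes [2 c t^2]; the result is positive, which is impossible at a
   maximum. *)
have c20 : 0 < c / 2 by rewrite divr_gt0.
have [d1 d10 h1] := lapu _ pd' _ c20.
have [d2 d20' h2] := lapu _ rpd' _ c20.
pose t := (Num.min (Num.min d1 d2) (Num.min (d - `|p|) (p 0 n))) / 2.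
have m0 : 0 < Num.min (Num.min d1 d2) (Num.min (d - `|p|) (p 0 n)).
  by rewrite !lt_min d10 d20' pn0 subr_gt0 pd'.
have t0 : 0 < t by rewrite divr_gt0.
have tm : t < Num.min (Num.min d1 d2) (Num.min (d - `|p|) (p 0 n)).
  by rewrite ltr_pdivrMr // ltr_pMr // ltr1n.
move: tm; rewrite !lt_min -andbA => /and4P[td1 td2 tdp tpn].
have {}h1 : `|second_diff u t p| <= c / 2 * t ^+ 2 by apply: h1; rewrite t0.
have {}h2 : `|second_diff u t (reflect n p)| <= c / 2 * t ^+ 2.
  by apply: h2; rewrite t0.
have Kstep s i : `|s| = t -> K (p + s *: evec i).
  move=> st; split.
    apply: le_trans (ler_normD _ _) _; rewrite norm_scale_evec st.
    by rewrite -lerBrDl ltW.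
  rewrite stepE; case: eqP => _ /=; last by rewrite mulr0 addr0.
  have : - s <= t by rewrite -st; apply: le_trans (ler_norm _) _; rewrite normrN.
  by rewrite mulr1; move: tpn; lra.
have wle : second_diff w t p <= 0.
  apply: sumr_le0 => i _.
  have w1 : w (p + t *: evec i) <= w p.
    by apply: maxp; rewrite inE; apply: Kstep; rewrite gtr0_norm.
  have w2 : w (p - t *: evec i) <= w p.
    by apply: maxp; rewrite inE -scaleNr; apply: Kstep; rewrite normrN gtr0_norm.
  by lra.
have wE : second_diff w t p = (second_diff u t p - second_diff u t (reflect n p)) / 2
    - c * second_diff (barrier n d) t p.
  rewrite -second_diff_reflect /second_diff -sumrB mulr_suml mulr_sumr -sumrB.
  by apply: eq_bigr => i _; rewrite /w; field.
move: wle; rewrite wE second_diff_barrier.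
have ct0 : 0 < c * t ^+ 2 by rewrite mulr_gt0 // exprn_gt0.
move: h1 h2; rewrite !ler_norml => /andP[a1 a2] /andP[b1 b2].
have -> : c * (- 2 * t ^+ 2) = - 2 * (c * t ^+ 2) by ring.
have e : c / 2 * t ^+ 2 = (c * t ^+ 2) / 2 by field.
rewrite e in a1 a2 b1 b2; lra.
Qed.

End GradientEstimate.

(** * Steklov averages *)

Section Mean.
Variables (R : realType) (eps : R).
Hypothesis eps0 : 0 < eps.
Local Notation mu := (@lebesgue_measure R).

Definition mean (f : R -> R) : R := eps^-1 * \int[mu]_(t in `[0, eps]) f t.

Definition continuous_seg (f : R -> R) : Prop :=
  forall t, 0 <= t <= eps -> {for t, continuous f}.

Lemma continuous_seg_integrable f : continuous_seg f ->
  mu.-integrable `[0, eps] (EFin \o f).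
Proof.
move=> cf; apply: continuous_compact_integrable; first exact: segment_compact.
by apply: continuous_in_subspaceT => t; rewrite inE /= in_itv /=; exact: cf.
Qed.

Lemma mean_lin (k : R) f g : continuous_seg f -> continuous_seg g ->
  mean (fun t => k * f t + g t) = k * mean f + mean g.
Proof.
move=> cf cg; rewrite /mean RintegralD //.
- rewrite RintegralZl //; last exact: continuous_seg_integrable.
  by ring.
- apply: (@continuous_seg_integrable (fun t => k * f t)) => t ht.
  exact: (cvgM (cvg_cst k) (cf t ht)).
- exact: continuous_seg_integrable.
Qed.

Lemma mean_cst (c : R) : mean (fun=> c) = c.
Proof.
rewrite /mean Rintegral_cst //= lebesgue_measure_itv /= lte_fin eps0 /= subr0.
by rewrite mulrCA mulVf ?mulr1 // gt_eqF.
Qed.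

Lemma mean_le f g : continuous_seg f -> continuous_seg g ->
  (forall t, 0 <= t <= eps -> f t <= g t) -> mean f <= mean g.
Proof.
move=> cf cg fg; rewrite /mean ler_pM2l ?invr_gt0 //.
by apply: le_Rintegral => //; exact: continuous_seg_integrable.
Qed.

Lemma mean_dist f (c eta : R) : continuous_seg f ->
  (forall t, 0 <= t <= eps -> `|f t - c| <= eta) -> `|mean f - c| <= eta.
Proof.
move=> cf H; have cc (k : R) : continuous_seg (fun=> k) by move=> t _; exact: cvg_cst.
have l : c - eta <= mean f.
  rewrite -(mean_cst (c - eta)); apply: mean_le => // t /H.
  by rewrite ler_norml => /andP[]; lra.
have u : mean f <= c + eta.
  rewrite -(mean_cst (c + eta)); apply: mean_le => // t /H.
  by rewrite ler_norml => /andP[]; lra.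
by rewrite ler_norml; apply/andP; split; lra.
Qed.

(** With [F] a primitive of [f], the shifted mean is [(F (s + eps) - F s) / eps]. The margin [rho]
    keeps [0] and [eps] interior to the interval on which [F] is differentiable. *)
Lemma is_derive_mean_shift f (rho : R) : 0 < rho ->
  (forall t, - rho < t < eps + rho -> {for t, continuous f}) ->
  is_derive (0:R) (1:R) (fun s => mean (fun t => f (s + t))) (eps^-1 * (f eps - f 0)).
Proof.
move=> rho0 cf; pose a := - (rho / 2); pose b := eps + rho / 2.
pose F (s : R) := \int[mu]_(t in `[a, s]) f t.
have dF s : a < s < b -> is_derive s (1:R) F (f s).
  move=> /andP[sa sb].
  have [|//||df <-] := @continuous_FTC1_closed R f a s b sb.
  - apply: continuous_compact_integrable; first exact: segment_compact.
    apply: continuous_in_subspaceT => t; rewrite inE /= in_itv /= => /andP[t1 t2].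
    by apply: cf; rewrite /a /b in t1 t2; apply/andP; split; lra.
  - by apply: cf; rewrite /a /b in sa sb; apply/andP; split; lra.
  - by rewrite derive1E; exact: derivableP.
have E s : `|s| < rho / 2 -> mean (fun t => f (s + t)) = eps^-1 * (F (s + eps) - F s).
  rewrite ltr_norml => /andP[s1 s2]; rewrite /mean /Rintegral.
  have dFs t : 0 <= t <= eps -> is_derive t (1:R) (fun t => F (s + t)) (f (s + t)).
    move=> /andP[t0 te]; have /is_deriveP H : is_derive (s + t) (1:R) F (f (s + t)).
      by apply: dF; rewrite /a /b; apply/andP; split; lra.
    apply/is_deriveP => eta e0; have [del d0 Hd] := H _ e0.
    by exists del => // u u0 ud; have := Hd u u0 ud; rewrite addrA.
  have cFs t : 0 <= t <= eps -> {for t, continuous (fun t => F (s + t))}.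
    by move=> /dFs[+ _] => /derivable1_diffP /differentiable_continuous.
  rewrite (@continuous_FTC2 R _ (fun t => F (s + t)) 0 eps) //=.
  - by rewrite addr0.
  - apply: continuous_in_subspaceT => t; rewrite inE /= in_itv /= => /andP[t1 t2].
    have cft : {for (s + t), continuous f} by apply: cf; apply/andP; split; lra.
    apply: (@continuous_comp _ _ _ (fun t => s + t) f) => //.
    by apply: (cvgD (cvg_cst s)); exact: cvg_id.
  - split.
    + by move=> t; rewrite in_itv /= => /andP[/ltW t1 /ltW t2]; have [] := dFs t; rewrite ?t1.
    + by apply: cvg_at_right_filter; apply: cFs; rewrite lexx ltW.
    + by apply: cvg_at_left_filter; apply: cFs; rewrite lexx ltW.
  - move=> t; rewrite in_itv /= => /andP[/ltW t1 /ltW t2].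
    by rewrite derive1E; have [] := dFs t; rewrite ?t1.
have r20 : 0 < rho / 2 by rewrite divr_gt0.
have D0 : is_derive (0:R) (1:R) F (f 0).
  by apply: dF; rewrite /a /b; apply/andP; split; have := eps0; lra.
have De : is_derive eps (1:R) F (f eps).
  by apply: dF; rewrite /a /b; apply/andP; split; have := eps0; lra.
apply/is_deriveP => eta e0.
(* Two differentiation errors, at [0] and at [eps], are added and then divided by [eps]. *)
have e1 : 0 < eta * eps / 2 by rewrite !mulr_gt0 ?invr_gt0.
have [d1 d10 H1] := (is_deriveP _ _ _ _).1 D0 _ e1.
have [d2 d20 H2] := (is_deriveP _ _ _ _).1 De _ e1.
exists (Num.min (rho / 2) (Num.min d1 d2)); first by rewrite !lt_min r20 d10.
move=> t t0; rewrite !lt_min => /and3P[tr t1 t2].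
have {}H1 := H1 t t0 t1; have {}H2 := H2 t t0 t2.
rewrite add0r /GRing.scale /= mulr1 in H1; rewrite /GRing.scale /= mulr1 in H2.
rewrite add0r /GRing.scale /= mulr1 !E ?normr0 // add0r [t + eps]addrC.
set x := t^-1 * (F (eps + t) - F eps) - f eps in H2.
set y := t^-1 * (F t - F 0) - f 0 in H1.
have -> : t^-1 * (eps^-1 * (F (eps + t) - F t) - eps^-1 * (F eps - F 0))
    - eps^-1 * (f eps - f 0) = (x - y) / eps.
  by rewrite /x /y; field; rewrite t0 gt_eqF.
rewrite normrM normfV (gtr0_norm eps0) ler_pdivrMr //.
apply: le_trans (ler_normB _ _) _.
by move: H1 H2; lra.
Qed.

End Mean.

(** * Averages along one coordinate axis *)

Section Average.
Variable R : realType.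
Local Notation R4 := 'rV[R]_4.
Local Notation evec := (@evec R).

Definition continuous_near (x0 : R4) (r : R) (g : R4 -> R) : Prop :=
  forall y : R4, `|y - x0| < r -> {for y, continuous g}.

Definition avg (eps : R) (i : 'I_4) (g : R4 -> R) : R4 -> R :=
  fun x => mean eps (fun t => g (x + t *: evec i)).

Lemma continuous_line (g : R4 -> R) (x v : R4) (t : R) :
  {for x + t *: v, continuous g} -> {for t, continuous (fun t : R => g (x + t *: v))}.
Proof.
move=> cg; apply: (@continuous_comp _ _ _ (fun u : R => x + u *: v) g) => //.
have h : u *: v @[u --> t] --> t *: v by apply: cvgZr_tmp; exact: cvg_id.
exact: (cvgD (cvg_cst x) h).
Qed.

(** Compactness of [[0, eps]] makes the continuity of [G] uniform along the segment; this is what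
    lets limits pass under [mean]. *)
Lemma segment_uniform_continuity (G : R4 -> R) (x v : R4) (eps eta : R) : 0 < eta ->
  (forall t : R, 0 <= t <= eps -> {for x + t *: v, continuous G}) ->
  exists2 del, 0 < del & forall (z : R4) (t : R), `|z| < del -> 0 <= t <= eps ->
    `|G (x + t *: v + z) - G (x + t *: v)| <= eta.
Proof.
move=> e0 cG.
have /compact_near_coveringP cov := @segment_compact R 0 eps.
have /nbhs_normP [del /= d0 Hd] : \forall z \near (0 : R4),
    `[0, eps] `<=` (fun t => `|G (x + t *: v + z) - G (x + t *: v)| <= eta).
  apply: (cov R4 (nbhs (0 : R4))
    (fun z t => `|G (x + t *: v + z) - G (x + t *: v)| <= eta) _) => t.
  rewrite /= in_itv /= => /cG /continuous_forP H.
  have e2 : 0 < eta / 2 by rewrite divr_gt0.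
  have [del d0 Hd] := H _ e2.
  have d2 : 0 < del / 2 by rewrite divr_gt0.
  (* The added 1 covers the case [v = 0]. *)
  have v0 : 0 < `|v| + 1 by rewrite ltr_wpDl.
  exists (ball t (del / 2 / (`|v| + 1)), ball (0 : R4) (del / 2)) => /=.
    by split; apply: nbhsx_ballx => //; rewrite divr_gt0.
  move=> [s z] /= []; rewrite -!ball_normE /ball_ /= => ts.
  rewrite sub0r normrN => zd.
  have sv : `|s *: v - t *: v| < del / 2.
    rewrite -scalerBl normrZ distrC.
    apply: le_lt_trans (_ : _ <= `|t - s| * (`|v| + 1)) _.
      by rewrite ler_wpM2l // lerDl.
    by rewrite -ltr_pdivlMr.
  have h1 : `|G (x + s *: v + z) - G (x + t *: v)| <= eta / 2.
    apply: Hd; rewrite -(addrA x) opprD addrACA subrr add0r addrAC.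
    by apply: le_lt_trans (ler_normD _ _) _; lra.
  have h2 : `|G (x + s *: v) - G (x + t *: v)| <= eta / 2.
    apply: Hd; rewrite opprD addrACA subrr add0r.
    by apply: lt_trans sv _; lra.
  have -> : G (x + s *: v + z) - G (x + s *: v) =
    (G (x + s *: v + z) - G (x + t *: v)) - (G (x + s *: v) - G (x + t *: v)) by ring.
  by apply: le_trans (ler_normB _ _) _; lra.
exists del => // z t zd ht; apply: (Hd z); last by rewrite /= in_itv.
by rewrite /= sub0r normrN.
Qed.

Variable eps : R.
Hypothesis eps0 : 0 < eps.

Lemma in_near_step x0 r (x : R4) i (t : R) : `|x - x0| < r -> 0 <= t <= eps ->
  `|x + t *: evec i - x0| < r + eps.
Proof.
move=> xr /andP[t0 te]; rewrite addrAC; apply: le_lt_trans (ler_normD _ _) _.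
by rewrite norm_scale_evec ger0_norm // ltr_leD.
Qed.

Lemma continuous_near_seg x0 r g x i : continuous_near x0 (r + eps) g -> `|x - x0| < r ->
  continuous_seg eps (fun t => g (x + t *: evec i)).
Proof.
by move=> cg xr t ht; apply: continuous_line; apply: cg; exact: in_near_step.
Qed.

Lemma avg_lin x0 r (k : R) g h i x : continuous_near x0 (r + eps) g ->
  continuous_near x0 (r + eps) h -> `|x - x0| < r ->
  avg eps i (fun y => k * g y + h y) x = k * avg eps i g x + avg eps i h x.
Proof.
by move=> cg ch xr; rewrite /avg mean_lin //; apply: continuous_near_seg xr.
Qed.

Lemma avg_dist x0 r g i (c eta : R) x : continuous_near x0 (r + eps) g ->
  (forall y, `|y - x0| < r + eps -> `|g y - c| <= eta) -> `|x - x0| < r ->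
  `|avg eps i g x - c| <= eta.
Proof.
move=> cg H xr; apply: mean_dist => //; first exact: continuous_near_seg xr.
by move=> t ht; apply: H; exact: in_near_step.
Qed.

Lemma avg_continuous x0 r g i : continuous_near x0 (r + eps) g ->
  continuous_near x0 r (avg eps i g).
Proof.
move=> cg x xr; apply/continuous_forP => eta e0.
have [|del d0 Hd] := @segment_uniform_continuity g x (evec i) eps eta e0.
  by move=> t ht; apply: cg; exact: in_near_step.
exists (Num.min del (r - `|x - x0|)); first by rewrite lt_min d0 subr_gt0.
move=> y; rewrite lt_min => /andP[yd yr].
have yr' : `|y - x0| < r.
  rewrite -(subrK x y) -addrA; apply: le_lt_trans (ler_normD _ _) _.
  by rewrite -ltrBrDr.
have -> : avg eps i g y - avg eps i g x =
    mean eps (fun t => (-1) * g (x + t *: evec i) + g (y + t *: evec i)) - 0.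
  rewrite mean_lin ?mulN1r ?subr0 1?addrC //.
  - exact: continuous_near_seg xr.
  - exact: continuous_near_seg yr'.
apply: mean_dist => //.
  move=> t ht; apply: cvgD.
    apply: cvgM; first exact: cvg_cst.
    exact: (continuous_near_seg cg xr).
  exact: (continuous_near_seg cg yr').
move=> t ht; rewrite subr0 mulN1r addrC.
have -> : y + t *: evec i = x + t *: evec i + (y - x).
  by rewrite [RHS]addrAC [x + (y - x)]addrC subrK.
exact: Hd.
Qed.

(** Fundamental theorem of calculus: along the axis of averaging a merely continuous [g] gains a
    derivative. *)
Lemma is_derive_avg_diag x0 r g i x : continuous_near x0 (r + eps) g -> `|x - x0| < r ->
  is_derive x (evec i) (avg eps i g) (eps^-1 * (g (x + eps *: evec i) - g x)).
Proof.
move=> cg xr.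
have := @is_derive_mean_shift R eps eps0 (fun t => g (x + t *: evec i)) (r - `|x - x0|).
rewrite subr_gt0 scale0r addr0 => /(_ xr) H.
suff D : is_derive (0:R) (1:R) (fun t => avg eps i g (x + t *: evec i))
    (eps^-1 * (g (x + eps *: evec i) - g x)).
  by have := is_derive_line_inv D; rewrite scale0r addr0.
have -> : (fun t => avg eps i g (x + t *: evec i)) =
    (fun s => mean eps (fun t => g (x + (s + t) *: evec i))).
  by apply/funext => s; congr mean; apply/funext => t; rewrite scalerDl addrA.
apply: H => t /andP[t1 t2].
apply: continuous_line; apply: cg; rewrite addrAC.
apply: le_lt_trans (ler_normD _ _) _; rewrite norm_scale_evec.
suff : `|t| < r + eps - `|x - x0| by lra.
by rewrite ltr_norml; apply/andP; split; have := eps0; lra.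
Qed.

(** Differentiation under the integral: the mean value theorem turns the quotient at each [t] into a
    nearby value of [g'], and uniform continuity along the segment compares it with [g'] at the
    unshifted point. *)
Lemma is_derive_avg x0 r (g g' : R4 -> R) i j x : continuous_near x0 (r + eps) g ->
  (forall y, `|y - x0| < r + eps -> is_derive y (evec j) g (g' y)) ->
  continuous_near x0 (r + eps) g' -> `|x - x0| < r ->
  is_derive x (evec j) (avg eps i g) (avg eps i g' x).
Proof.
move=> cg dg cg' xr; apply/is_deriveP => eta e0.
have [|del d0 Hd] := @segment_uniform_continuity g' x (evec i) eps eta e0.
  by move=> t ht; apply: cg'; exact: in_near_step.
exists (Num.min del (r - `|x - x0|)); first by rewrite lt_min d0 subr_gt0.
move=> s s0; rewrite lt_min => /andP[sd sr].
have step (c : R) : `|c| <= `|s| -> `|x + c *: evec j - x0| < r.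
  move=> cs; rewrite addrAC; apply: le_lt_trans (ler_normD _ _) _.
  by rewrite norm_scale_evec; lra.
have yr' := step s (lexx _).
have c1 := continuous_near_seg (i := i) cg xr.
have c2 := continuous_near_seg (i := i) cg yr'.
have c3 := continuous_near_seg (i := i) cg' xr.
pose q t := (-1) * g (x + t *: evec i) + g (x + s *: evec j + t *: evec i).
have cq : continuous_seg eps q.
  by move=> t ht; apply: cvgD; [apply: cvgM; [exact: cvg_cst|exact: c1]|exact: c2].
have c4 : continuous_seg eps (fun t => (-1) * g' (x + t *: evec i)).
  by move=> t ht; apply: cvgM; [exact: cvg_cst|exact: c3].
have c0 : continuous_seg eps (fun _ : R => 0 : R) by move=> t _; exact: cvg_cst.
(* The error is written as a single mean, so that a pointwise bound on the integrand suffices; the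
   inner [+ 0] gives the last summand the shape required by [mean_lin]. *)
have -> : s^-1 * (avg eps i g (x + s *: evec j) - avg eps i g x) - avg eps i g' x =
    mean eps (fun t => s^-1 * q t + ((-1) * g' (x + t *: evec i) + 0)) - 0.
  rewrite subr0 mean_lin //; last first.
    by move=> t ht; apply: cvgD; [exact: c4|exact: cvg_cst].
  rewrite (mean_lin (-1) c3 c0) (mean_cst eps0) (mean_lin (-1) c1 c2) addr0 !mulN1r.
  by rewrite [- _ + _]addrC.
apply: mean_dist => //.
  move=> t ht; apply: cvgD; last by apply: cvgD; [exact: c4|exact: cvg_cst].
  by apply: cvgM; [exact: cvg_cst|exact: cq].
move=> t ht; rewrite /q subr0 addr0 !mulN1r.
have -> : x + s *: evec j + t *: evec i = x + t *: evec i + s *: evec j by rewrite addrAC.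
have [|c cs] := @MVT_line R g g' (x + t *: evec i) (evec j) s.
  move=> c cs; apply: dg; rewrite [_ + c *: _]addrAC; apply: in_near_step => //.
  exact: step.
rewrite [- _ + _]addrC => ->; rewrite mulrA mulVf // mul1r.
by apply: Hd => //; rewrite norm_scale_evec; exact: le_lt_trans cs sd.
Qed.

End Average.

(** * Second differences by Taylor expansion along the axes *)

Section SecondDifference.
Variable R : realType.
Local Notation R4 := 'rV[R]_4.
Local Notation evec := (@evec R).

(** The mean value theorem is applied to [f] minus its quadratic part: the derivative at [c] is
    [f1 c - f1 0 - f2 * c], which is small compared with [c] because [f1] is differentiable at 0. *)
Lemma taylor2_bound (f f1 : R -> R) (f2 rho eta : R) : 0 < rho -> 0 < eta ->
  (forall s : R, `|s| < rho -> is_derive s (1:R) f (f1 s)) ->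
  is_derive (0:R) (1:R) f1 f2 ->
  exists2 del, 0 < del & forall s : R, `|s| < del ->
    `|f s - f 0 - (f1 0 * s + f2 / 2 * s ^+ 2)| <= eta * s ^+ 2.
Proof.
move=> rho0 e0 df df1; have [d d0 Hd] := (is_deriveP _ _ _ _).1 df1 _ e0.
exists (Num.min rho d); first by rewrite lt_min rho0.
move=> s; rewrite lt_min => /andP[sr sd].
pose T u := f u - (f1 0 * u + f2 / 2 * u ^+ 2).
have [c cs|c cs E] := @MVT_R R T (fun u => f1 u - f1 0 - f2 * u) s.
  have dc := df c (le_lt_trans cs sr).
  have dq : is_derive c (1:R) (fun u : R => f1 0 * u + f2 / 2 * u ^+ 2) (f1 0 + f2 * c).
    apply/is_deriveP => e ep.
    have f20 : 0 < `|f2| + 1 by rewrite ltr_wpDl.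
    exists (e / (`|f2| + 1)) => [|u u0]; first by rewrite divr_gt0.
    rewrite ltr_pdivlMr // => ue; rewrite /GRing.scale /= mulr1.
    have -> : u^-1 * (f1 0 * (c + u) + f2 / 2 * (c + u) ^+ 2 -
      (f1 0 * c + f2 / 2 * c ^+ 2)) - (f1 0 + f2 * c) = u * (f2 / 2) by field.
    rewrite normrM normf_div; apply: le_trans (ltW ue); rewrite ler_wpM2l //.
    rewrite [`|2|]ger0_norm // ler_pdivrMr //.
    by have := normr_ge0 f2; lra.
  by apply: (is_derive_eq (is_deriveB dc dq)); ring.
have -> : f s - f 0 - (f1 0 * s + f2 / 2 * s ^+ 2) = T s - T 0 by rewrite /T; ring.
rewrite E normrM -[s ^+ 2]real_normK ?num_real // expr2 mulrCA.
rewrite ler_wpM2l //; apply: le_trans (_ : _ <= eta * `|c|) _; last by rewrite ler_wpM2l // ltW.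
have [->|c0] := eqVneq c 0; first by rewrite subrr mulr0 subrr normr0 mulr0.
have := Hd c c0 (le_lt_trans cs sd); rewrite add0r /GRing.scale /= mulr1 => H.
have -> : f1 c - f1 0 - f2 * c = (c^-1 * (f1 c - f1 0) - f2) * c by field.
by rewrite normrM ler_wpM2r.
Qed.

(** The first-order Taylor terms at [t] and [- t] cancel, and the second-order ones add up to
    [t ^+ 2] times the sum of the [F2 j]. *)
Lemma asymp_harmonic_of_derive (F : R4 -> R) (F1 : 'I_4 -> R4 -> R) (F2 : 'I_4 -> R)
    (x : R4) (rho : R) : 0 < rho ->
  (forall j (y : R4), `|y - x| < rho -> is_derive y (evec j) F (F1 j y)) ->
  (forall j, is_derive x (evec j) (F1 j) (F2 j)) ->
  \sum_j F2 j = 0 -> asymp_harmonic F x.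
Proof.
move=> rho0 dF dF1 sF eta e0.
(* Eight Taylor remainders are added: four axes, two signs. *)
have e8 : 0 < eta / 8 by rewrite divr_gt0.
have main j : exists2 del, 0 < del & forall s : R, `|s| < del ->
    `|F (x + s *: evec j) - F x - (F1 j x * s + F2 j / 2 * s ^+ 2)| <= eta / 8 * s ^+ 2.
  have [||del d0 Hd] := @taylor2_bound (fun s => F (x + s *: evec j))
     (fun s => F1 j (x + s *: evec j)) (F2 j) rho (eta / 8) rho0 e8.
  - move=> s sr; apply: is_derive_line; apply: dF.
    by rewrite addrAC subrr add0r norm_scale_evec.
  - by apply: is_derive_line; rewrite scale0r addr0.
  by exists del => // s /Hd; rewrite scale0r addr0.
have /choice [del Hdel] : forall j, exists d, 0 < d /\ forall s : R, `|s| < d ->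
    `|F (x + s *: evec j) - F x - (F1 j x * s + F2 j / 2 * s ^+ 2)| <= eta / 8 * s ^+ 2.
  by move=> j; have [d d0 Hd] := main j; exists d.
have del0 j : 0 < del j by case: (Hdel j).
exists (\big[Num.min/1]_j del j).
  by elim/big_ind: _ => // a b a0 b0; rewrite lt_min a0.
move=> t /andP[t0 td].
have tdel j : t < del j.
  by apply: lt_le_trans td _; exact: (bigmin_le_cond _ del).
have -> : second_diff F t x = \sum_j
    ((F (x + t *: evec j) - F x - (F1 j x * t + F2 j / 2 * t ^+ 2)) +
     (F (x + (- t) *: evec j) - F x - (F1 j x * (- t) + F2 j / 2 * (- t) ^+ 2))).
  transitivity (second_diff F t x - (\sum_j F2 j) * t ^+ 2); first by rewrite sF mul0r subr0.
  rewrite mulr_suml /second_diff -sumrB.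
  by apply: eq_bigr => j _; rewrite scaleNr; field.
apply: le_trans (ler_norm_sum _ _ _) _.
apply: le_trans (_ : _ <= \sum_(j < 4) (eta / 4 * t ^+ 2)) _; last first.
  by rewrite sumr_const card_ord -mulr_natl; lra.
apply: ler_sum => j _; apply: le_trans (ler_normD _ _) _.
have h1 := (Hdel j).2 t; rewrite gtr0_norm // in h1.
have h2 := (Hdel j).2 (- t); rewrite normrN gtr0_norm // sqrrN in h2.
have := h1 (tdel j); have := h2 (tdel j); rewrite sqrrN.
have -> : eta / 4 * t ^+ 2 = eta / 8 * t ^+ 2 + eta / 8 * t ^+ 2 by field.
by move=> a b; apply: lerD.
Qed.

End SecondDifference.

Lemma continuous_translate (R : realType) (g : 'rV[R]_4 -> R) (v y : 'rV[R]_4) :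
  {for y + v, continuous g} -> {for y, continuous (fun z : 'rV[R]_4 => g (z + v))}.
Proof.
move=> /continuous_forP H; apply/continuous_forP => eta e0.
have [d d0 Hd] := H _ e0; exists d => // z zy; apply: Hd.
by rewrite opprD addrACA subrr addr0.
Qed.

(** * Iterated averages and difference quotients *)

Section IteratedAverage.
Variables (R : realType) (eps : R).
Hypothesis eps0 : 0 < eps.
Local Notation R4 := 'rV[R]_4.
Local Notation evec := (@evec R).

(** Over [enum 'I_4] this is the Steklov average over a cube of side [eps]; keeping the list of axes
    makes it possible to drop one after differentiating along it. *)
Definition avgs (s : seq 'I_4) (g : R4 -> R) : R4 -> R := foldr (avg eps) g s.

Definition diffq (h : R) (j : 'I_4) (g : R4 -> R) : R4 -> R :=
  fun x => h^-1 * (g (x + h *: evec j) - g x).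

Lemma continuous_near_le (x0 : R4) r r' (g : R4 -> R) : r' <= r ->
  continuous_near x0 r g -> continuous_near x0 r' g.
Proof. by move=> rr cg y yr; apply: cg; exact: lt_le_trans yr rr. Qed.

Lemma continuous_near_diffq (x0 : R4) r h j (g : R4 -> R) : 0 < h ->
  continuous_near x0 (r + h) g -> continuous_near x0 r (diffq h j g).
Proof.
move=> h0 cg y yr.
have ygr : `|y + h *: evec j - x0| < r + h.
  rewrite addrAC; apply: le_lt_trans (ler_normD _ _) _.
  by rewrite norm_scale_evec gtr0_norm // ltrD2r.
have c1 : g (z + h *: evec j) @[z --> y] --> g (y + h *: evec j).
  by apply: continuous_translate; exact: cg.
have c2 : g z @[z --> y] --> g y by apply: cg; apply: lt_trans yr _; rewrite ltrDl.
exact: (cvgM (cvg_cst h^-1) (cvgB c1 c2)).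
Qed.

(** Each average reaches at most [eps] further, hence the loss of [eps *+ size s] in the radius here
    and below. *)
Lemma avgs_continuous s (x0 : R4) r g : continuous_near x0 (r + eps *+ size s) g ->
  continuous_near x0 r (avgs s g).
Proof.
elim: s r => [|i s IH] r /=; first by rewrite mulr0n addr0.
by rewrite mulrS addrA => /IH; exact: avg_continuous.
Qed.

Lemma avgs_lin s (x0 : R4) r (k : R) g h (x : R4) : continuous_near x0 (r + eps *+ size s) g ->
  continuous_near x0 (r + eps *+ size s) h -> `|x - x0| < r ->
  avgs s (fun y => k * g y + h y) x = k * avgs s g x + avgs s h x.
Proof.
elim: s r x => [|i s IH] r x //=; rewrite mulrS addrA => cg ch xr.
have c1 := avgs_continuous cg; have c2 := avgs_continuous ch.
rewrite -(avg_lin k i c1 c2 xr) /avg; congr (_ * _).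
apply: eq_Rintegral => t; rewrite inE /= in_itv /= => ht.
by rewrite (IH (r + eps)) //; exact: in_near_step.
Qed.

Lemma avgs_dist s (x0 : R4) r g (c eta : R) (x : R4) : continuous_near x0 (r + eps *+ size s) g ->
  (forall y : R4, `|y - x0| < r + eps *+ size s -> `|g y - c| <= eta) -> `|x - x0| < r ->
  `|avgs s g x - c| <= eta.
Proof.
elim: s r x => [|i s IH] r x /=; first by rewrite mulr0n addr0 => _; exact.
rewrite mulrS addrA => cg H xr.
apply: (avg_dist eps0 i (avgs_continuous cg) _ xr) => y; exact: IH.
Qed.

Lemma avgs_shift s g (v x : R4) : avgs s (fun y : R4 => g (y + v)) x = avgs s g (x + v).
Proof.
elim: s x => //= i s IH x; rewrite /avg; congr mean.
by apply/funext => t; rewrite IH addrAC.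
Qed.

Lemma avgs_diffq s (x0 : R4) r g j (x : R4) : continuous_near x0 (r + eps + eps *+ size s) g ->
  `|x - x0| < r -> diffq eps j (avgs s g) x = avgs s (diffq eps j g) x.
Proof.
move=> cg xr.
have c1 : continuous_near x0 (r + eps *+ size s) (fun y : R4 => eps^-1 * g (y + eps *: evec j)).
  move=> y yr.
  have : {for (y + eps *: evec j), continuous g}.
    apply: cg; rewrite addrAC; apply: le_lt_trans (ler_normD _ _) _.
    by rewrite norm_scale_evec gtr0_norm // [X in _ < X]addrAC ltrD2r.
  by move=> /continuous_translate cgy; exact: (cvgM (cvg_cst eps^-1) cgy).
have c2 : continuous_near x0 (r + eps *+ size s) g.
  by apply: continuous_near_le cg; rewrite lerD2r lerDl ltW.
have c0 (k : R) : continuous_near x0 (r + eps *+ size s) (fun=> k).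
  by move=> y _; exact: cst_continuous.
have -> : diffq eps j g = (fun y => (- eps^-1) * g y + eps^-1 * g (y + eps *: evec j)).
  by apply/funext => y; rewrite /diffq; ring.
rewrite (avgs_lin _ c2 c1 xr).
have -> : (fun y : R4 => eps^-1 * g (y + eps *: evec j)) =
    (fun y => eps^-1 * g (y + eps *: evec j) + 0) by apply/funext => y; rewrite addr0.
have c3 : continuous_near x0 (r + eps *+ size s) (fun y => g (y + eps *: evec j)).
  move=> y yr; have := c1 y yr => /(cvgM (cvg_cst eps)).
  have -> : cst eps \* (fun y => eps^-1 * g (y + eps *: evec j)) = (fun y => g (y + eps *: evec j)).
    by apply/funext => z /=; rewrite mulrA divff ?mul1r // gt_eqF.
  by rewrite /= mulrA divff ?mul1r // gt_eqF.
rewrite (avgs_lin _ c3 (c0 0) xr) avgs_shift.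
have -> : avgs s (fun=> 0) x = 0.
  apply/eqP; rewrite -normr_le0 -[X in `|X|]subr0.
  by apply: (avgs_dist (c0 0) _ xr) => y _; rewrite subr0 normr0.
by rewrite /diffq; ring.
Qed.

Lemma is_derive_avgs s (x0 : R4) r (g g' : R4 -> R) j x :
  continuous_near x0 (r + eps *+ size s) g ->
  (forall y : R4, `|y - x0| < r + eps *+ size s -> is_derive y (evec j) g (g' y)) ->
  continuous_near x0 (r + eps *+ size s) g' -> `|x - x0| < r ->
  is_derive x (evec j) (avgs s g) (avgs s g' x).
Proof.
elim: s r x => [|i s IH] r x /=; first by rewrite mulr0n addr0 => _ dg _; exact: dg.
rewrite mulrS addrA => cg dg cg' xr.
apply: (is_derive_avg eps0 i (avgs_continuous cg) _ (avgs_continuous cg') xr) => y yr.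
exact: IH.
Qed.

(** The average along [j] absorbs the derivative; the averages outside it are differentiated under
    the integral, and those inside it commute with the difference quotient. *)
Lemma is_derive_avgs_mem s (x0 : R4) r g j (x : R4) : j \in s ->
  continuous_near x0 (r + eps *+ size s) g -> `|x - x0| < r ->
  is_derive x (evec j) (avgs s g) (avgs (rem j s) (diffq eps j g) x).
Proof.
elim: s r x => //= i s IH r x; rewrite inE mulrS addrA => js cg xr.
have ca := avgs_continuous cg.
have [ij|ij] := eqVneq i j.
  rewrite -ij -(avgs_diffq _ cg xr).
  exact: (is_derive_avg_diag eps0 i ca xr).
rewrite eq_sym (negbTE ij) /= in js.
apply: (is_derive_avg eps0 i ca _ _ xr) => [y yr|]; first exact: (IH (r + eps)).
apply: avgs_continuous; apply: continuous_near_diffq => //.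
apply: continuous_near_le cg; rewrite size_rem //.
have s0 : (0 < size s)%N by case: (s) js.
by rewrite -(prednK s0) mulrSr /= addrA.
Qed.

End IteratedAverage.

(** * Mixed second derivatives of averages *)

Section MixedAverages.
Variables (R : realType) (eps : R).
Hypothesis eps0 : 0 < eps.
Local Notation R4 := 'rV[R]_4.
Local Notation evec := (@evec R).

Definition nball (x0 : R4) (r : R) : set R4 := [set y | `|y - x0| < r].

Lemma is_Cn_continuous n (U : set R4) (f : R4 -> R) x : is_Cn n U f -> U x -> {for x, continuous f}.
Proof. by case: n => [|n] [h _]; exact: h. Qed.

Lemma is_Cn_is_derive n (U : set R4) (f : R4 -> R) i x : is_Cn n.+1 U f -> U x ->
  is_derive x (evec i) f (partial i f x).
Proof. by case=> _ h Ux; apply: derivableP; have [d _] := h i; exact: d. Qed.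

Lemma is_Cn_partial n (U : set R4) (f : R4 -> R) i : is_Cn n.+1 U f -> is_Cn n U (partial i f).
Proof. by case=> _ h; case: (h i). Qed.

Lemma is_C1_partial_continuous U (f : R4 -> R) i x :
  is_Cn 1 U f -> U x -> {for x, continuous (partial i f)}.
Proof. by move=> Cf Ux; exact: is_Cn_continuous (is_Cn_partial i Cf) Ux. Qed.

Lemma is_derive_translate (g : R4 -> R) (v x e : R4) (d : R) :
  is_derive (x + v) e g d -> is_derive x e (fun z : R4 => g (z + v)) d.
Proof.
move/is_deriveP => H; apply/is_deriveP => eta e0; have [del d0 Hd] := H _ e0.
by exists del => // t t0 td; have := Hd t t0 td; rewrite [x + v + _]addrAC.
Qed.

Lemma is_derive_diffq h j (g g' : R4 -> R) (y e : R4) :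
  is_derive y e g (g' y) ->
  is_derive (y + h *: evec j) e g (g' (y + h *: evec j)) ->
  is_derive y e (diffq h j g) (diffq h j g' y).
Proof.
move=> h1 /is_derive_translate h2.
exact: (is_deriveZ h^-1 (is_deriveB h2 h1)).
Qed.

Lemma nball_step (x0 y : R4) r (t : R) j :
  nball x0 r y -> nball x0 (r + `|t|) (y + t *: evec j).
Proof.
rewrite /nball /= => yr; rewrite addrAC; apply: le_lt_trans (ler_normD _ _) _.
by rewrite norm_scale_evec ltrD2r.
Qed.

Lemma size_rem_addr (r : R) (s : seq 'I_4) j : j \in s ->
  r + eps *+ size (rem j s) + eps = r + eps *+ size s.
Proof.
move=> js; rewrite size_rem //; have s0 : (0 < size s)%N by case: (s) js.
by rewrite -[in RHS](prednK s0) mulrSr addrA.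
Qed.

(** Schwarz's theorem for averages of a C^1 function: each side equals the average, over the
    remaining axes, of the second difference quotient of [b] along [j] and [l], which is
    symmetric. *)
Lemma avgs_diffq_mixed (s : seq 'I_4) (x0 : R4) r (b : R4 -> R) j l x :
  uniq s -> j \in s -> l \in s -> j != l ->
  is_Cn 1 (nball x0 (r + eps *+ size s)) b -> nball x0 r x ->
  avgs eps (rem j s) (diffq eps j (partial l b)) x =
  avgs eps (rem l s) (diffq eps l (partial j b)) x.
Proof.
move=> us.
have main j' l' : j' \in s -> l' \in s -> j' != l' ->
    is_Cn 1 (nball x0 (r + eps *+ size s)) b -> nball x0 r x ->
    avgs eps (rem j' s) (diffq eps j' (partial l' b)) x =
    avgs eps (rem l' (rem j' s)) (diffq eps l' (diffq eps j' b)) x.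
  move=> js ls jl Cb xr; have E := size_rem_addr r js.
  have cb : continuous_near x0 (r + eps *+ size (rem j' s)) (diffq eps j' b).
    by apply: continuous_near_diffq => // y; rewrite E => yr; exact: (is_Cn_continuous Cb yr).
  have cb' : continuous_near x0 (r + eps *+ size (rem j' s)) (diffq eps j' (partial l' b)).
    apply: continuous_near_diffq => // y; rewrite E => yr.
    exact: (is_C1_partial_continuous Cb yr).
  (* The derivative along [l'] is computed twice: under the integral here, and through the average
     along [l'] in [h2]. *)
  have h1 : is_derive x (evec l') (avgs eps (rem j' s) (diffq eps j' b))
      (avgs eps (rem j' s) (diffq eps j' (partial l' b)) x).
    apply: (is_derive_avgs eps0 cb _ cb' xr) => y yr.
    apply: (is_derive_diffq (g' := partial l' b)).
      by apply: is_Cn_is_derive Cb _; rewrite -E; apply: lt_trans yr _; rewrite ltrDl.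
    apply: is_Cn_is_derive Cb _; rewrite -E.
    by have := nball_step eps j' yr; rewrite gtr0_norm.
  have lr : l' \in rem j' s by rewrite mem_rem_uniq // inE eq_sym jl.
  have h2 := is_derive_avgs_mem eps0 lr cb xr.
  by rewrite -(@derive_val _ _ _ _ _ _ _ h1) -(@derive_val _ _ _ _ _ _ _ h2).
move=> js ls jl Cb xr; rewrite main // [RHS]main 1?eq_sym //.
have -> : rem l (rem j s) = rem j (rem l s).
  rewrite !rem_filter ?filter_uniq ?rem_uniq // -!filter_predI.
  by apply: eq_filter => y /=; rewrite andbC.
congr (avgs _ _ _ _); apply/funext => y; rewrite /diffq.
by rewrite [y + _ + _]addrAC; ring.
Qed.

(** Averaged form of differentiating a linear relation along [j]: quotients and averages are linear,
    and the relation holds at the shifted point too. *)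
Lemma avgs_diffq_comb (s : seq 'I_4) (x0 : R4) r (g1 g2 g3 g4 : R4 -> R)
    (k1 k2 k3 k4 : R) j x :
  j \in s ->
  continuous_near x0 (r + eps *+ size s) g1 -> continuous_near x0 (r + eps *+ size s) g2 ->
  continuous_near x0 (r + eps *+ size s) g3 -> continuous_near x0 (r + eps *+ size s) g4 ->
  (forall y, nball x0 (r + eps *+ size s) y ->
     k1 * g1 y + k2 * g2 y + k3 * g3 y + k4 * g4 y = 0) ->
  nball x0 r x ->
  k1 * avgs eps (rem j s) (diffq eps j g1) x + k2 * avgs eps (rem j s) (diffq eps j g2) x
  + k3 * avgs eps (rem j s) (diffq eps j g3) x
  + k4 * avgs eps (rem j s) (diffq eps j g4) x = 0.
Proof.
move=> js c1 c2 c3 c4 sum0 xr; have E := size_rem_addr r js.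
set s' := rem j s.
have cd g : continuous_near x0 (r + eps *+ size s) g ->
    continuous_near x0 (r + eps *+ size s') (diffq eps j g).
  by rewrite -E => cg; exact: continuous_near_diffq.
have {}c1 := cd _ c1; have {}c2 := cd _ c2; have {}c3 := cd _ c3; have {}c4 := cd _ c4.
have c0 : continuous_near x0 (r + eps *+ size s') (fun=> 0 : R).
  by move=> y _; exact: cst_continuous.
have cl k g h : continuous_near x0 (r + eps *+ size s') g ->
    continuous_near x0 (r + eps *+ size s') h ->
    continuous_near x0 (r + eps *+ size s') (fun y => k * g y + h y).
  by move=> cg ch y yr; exact: (cvgD (cvgM (cvg_cst k) (cg y yr)) (ch y yr)).
have z0 h : continuous_near x0 (r + eps *+ size s') h ->
    (forall y : R4, `|y - x0| < r + eps *+ size s' -> h y = 0) -> avgs eps s' h x = 0.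
  move=> ch hz; apply/eqP; rewrite -normr_le0 -[X in `|X|]subr0.
  by apply: (avgs_dist eps0 ch _ xr) => y yr; rewrite hz // subr0 normr0.
have := z0 _ (cl k1 _ _ c1 (cl k2 _ _ c2 (cl k3 _ _ c3 (cl k4 _ _ c4 c0)))).
rewrite (avgs_lin eps0 k1 c1 (cl k2 _ _ c2 (cl k3 _ _ c3 (cl k4 _ _ c4 c0))) xr).
rewrite (avgs_lin eps0 k2 c2 (cl k3 _ _ c3 (cl k4 _ _ c4 c0)) xr).
rewrite (avgs_lin eps0 k3 c3 (cl k4 _ _ c4 c0) xr) (avgs_lin eps0 k4 c4 c0 xr).
rewrite (z0 _ c0) // addr0 !addrA => -> // y yr.
have s1 := sum0 _ (lt_trans yr (_ : r + eps *+ size s' < r + eps *+ size s)).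
have s2 := sum0 (y + eps *: evec j).
rewrite -E ltrDl in s1; rewrite -E in s2.
have {}s1 := s1 eps0.
have {}s2 : k1 * g1 (y + eps *: evec j) + k2 * g2 (y + eps *: evec j)
   + k3 * g3 (y + eps *: evec j) + k4 * g4 (y + eps *: evec j) = 0.
  by apply: s2; have := nball_step eps j yr; rewrite gtr0_norm.
rewrite /diffq addr0; transitivity (eps^-1 * (0 - 0)); last by rewrite subr0 mulr0.
by rewrite -{1}s2 -s1; ring.
Qed.

End MixedAverages.

(** * Regularity of the real first-order system *)

Section CauchyRiemann.
Variable R : realType.
Local Notation R4 := 'rV[R]_4.
Local Notation evec := (@evec R).

(* The real form of [D^(1) f = 0] for [f_0' = a + i b] and [f_1' = c + i d]. *)
Definition CR_system (U : set R4) (a b c d : R4 -> R) : Prop :=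
  [/\ is_Cn 1 U a, is_Cn 1 U b, is_Cn 1 U c & is_Cn 1 U d] /\
  forall x, U x ->
  [/\ partial 2 a x - partial 3 b x + partial 0 c x - partial 1 d x = 0,
      partial 2 b x + partial 3 a x + partial 0 d x + partial 1 c x = 0,
      partial 0 a x + partial 1 b x - partial 2 c x - partial 3 d x = 0
    & partial 0 b x - partial 1 a x - partial 2 d x + partial 3 c x = 0].

Lemma sum_ord4 (V : nmodType) (F : 'I_4 -> V) : \sum_i F i = F 0 + F 1 + F 2 + F 3.
Proof.
rewrite !big_ord_recr big_ord0 /= add0r.
by congr (F _ + F _ + F _ + F _); apply: val_inj.
Qed.

(** The first derivative is taken under the integral, the second becomes a difference quotient; with
    that reading the four equations are differentiated along the axes 2, 3, 0, 1 and combined. *)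
Lemma avgs_asymp_harmonic (eps : R) (x0 : R4) r a b c d x : 0 < eps ->
  CR_system (nball x0 (r + eps *+ 4)) a b c d -> nball x0 r x ->
  asymp_harmonic (avgs eps (enum 'I_4) a) x.
Proof.
move=> eps0 [[Ca Cb Cc Cd] eqs] xr.
pose s := enum 'I_4; have sz : size s = 4%N by rewrite size_enum_ord.
have js j : j \in s by rewrite mem_enum.
have us : uniq s by exact: enum_uniq.
have E4 : eps *+ 4 = eps *+ size s by rewrite sz.
rewrite E4 in Ca Cb Cc Cd eqs.
have cp f j : is_Cn 1 (nball x0 (r + eps *+ size s)) f ->
    continuous_near x0 (r + eps *+ size s) (partial j f).
  by move=> Cf y yr; exact: is_C1_partial_continuous Cf yr.
(* This is the derivative along [j] of the average of [partial l f], with the average along [j] used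
   up. *)
pose H j l f := avgs eps (rem j s) (diffq eps j (partial l f)) x.
apply: (@asymp_harmonic_of_derive R _ (fun j => avgs eps s (partial j a))
    (fun j => H j j a) x (r - `|x - x0|)).
- by rewrite subr_gt0.
- move=> j y yx; apply: (@is_derive_avgs R eps eps0 s x0 r).
  + by move=> z zr; exact: is_Cn_continuous Ca zr.
  + by move=> z zr; exact: is_Cn_is_derive Ca zr.
  + exact: cp.
  + rewrite -(subrK x y) -addrA; apply: le_lt_trans (ler_normD _ _) _.
    by rewrite -ltrBrDr.
- by move=> j; apply: (is_derive_avgs_mem eps0 (js j) (cp a j Ca) xr).
have mix f j l : is_Cn 1 (nball x0 (r + eps *+ size s)) f -> j != l -> H j l f = H l j f.
  by move=> Cf jl; apply: (avgs_diffq_mixed eps0 us (js j) (js l) jl Cf xr).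
have e2 : 1 * H 2 2 a + (-1) * H 2 3 b + 1 * H 2 0 c + (-1) * H 2 1 d = 0.
  apply: (avgs_diffq_comb eps0 (js 2) (cp a 2 Ca) (cp b 3 Cb) (cp c 0 Cc) (cp d 1 Cd) _ xr).
  by move=> y /eqs[<- _ _ _]; ring.
have e3 : 1 * H 3 2 b + 1 * H 3 3 a + 1 * H 3 0 d + 1 * H 3 1 c = 0.
  apply: (avgs_diffq_comb eps0 (js 3) (cp b 2 Cb) (cp a 3 Ca) (cp d 0 Cd) (cp c 1 Cc) _ xr).
  by move=> y /eqs[_ <- _ _]; ring.
have e0 : 1 * H 0 0 a + 1 * H 0 1 b + (-1) * H 0 2 c + (-1) * H 0 3 d = 0.
  apply: (avgs_diffq_comb eps0 (js 0) (cp a 0 Ca) (cp b 1 Cb) (cp c 2 Cc) (cp d 3 Cd) _ xr).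
  by move=> y /eqs[_ _ <- _]; ring.
have e1 : 1 * H 1 0 b + (-1) * H 1 1 a + (-1) * H 1 2 d + 1 * H 1 3 c = 0.
  apply: (avgs_diffq_comb eps0 (js 1) (cp b 0 Cb) (cp a 1 Ca) (cp d 2 Cd) (cp c 3 Cc) _ xr).
  by move=> y /eqs[_ _ _ <-]; ring.
(* The Laplacian is [e0 - e1 + e2 + e3], once the mixed terms of [b], [c], [d] are paired by
   [mix]. *)
rewrite sum_ord4.
rewrite (mix b 3 2) // (mix b 1 0) // (mix c 2 0) // (mix c 3 1) // in e0 e1 e2 e3.
rewrite (mix d 2 1) // (mix d 3 0) // in e0 e1 e2 e3.
clear -e0 e1 e2 e3; clearbody H; move: e0 e1 e2 e3.
move: (H 0 0 a) (H 1 1 a) (H 2 2 a) (H 3 3 a) => a0 a1 a2 a3.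
move: (H 2 3 b) (H 0 1 b) (H 0 2 c) (H 1 3 c) (H 1 2 d) (H 0 3 d) => b1 b2 c1 c2 d1 d2.
lra.
Qed.

(** [odd_part_bound] is applied to averages of [a], translated to be centred at [x]. Averaging
    preserves the bound [M], so the estimate survives as [eps] tends to 0. *)
Lemma CR_difference_le (x0 : R4) (r M D h : R) a b c d x n :
  CR_system (nball x0 r) a b c d -> 0 < M -> (forall y, nball x0 r y -> `|a y| <= M) ->
  0 < D -> `|x - x0| + D < r -> 0 <= h <= D ->
  a (x + h *: evec n) - a (x - h *: evec n) <= 10 * M * h / D.
Proof.
move=> S M0 aM D0 xD hD; have [[Ca _ _ _] _] := S.
apply/ler_addgt0Pr => eta e0.
have e2 : 0 < eta / 2 by rewrite divr_gt0.
have inb (y : R4) : `|y - x| <= D -> nball x0 r y.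
  move=> yx; rewrite /nball /= -(subrK x y) -addrA.
  by apply: le_lt_trans (ler_normD _ _) _; lra.
have hn : `|h| <= D by case/andP: hD => h0 hD; rewrite ger0_norm.
have bp : nball x0 r (x + h *: evec n).
  by apply: inb; rewrite addrAC subrr add0r norm_scale_evec.
have bm : nball x0 r (x - h *: evec n).
  by apply: inb; rewrite addrAC subrr add0r normrN norm_scale_evec.
have close p : nball x0 r p -> exists2 del, 0 < del & forall eps, 0 < eps -> eps < del ->
    `|avgs eps (enum 'I_4) a p - a p| <= eta / 2.
  move=> pr; have [del d0 Hd] := (continuous_forP _ _).1 (is_Cn_continuous Ca pr) _ e2.
  have m0 : 0 < Num.min del (r - `|p - x0|) by rewrite lt_min d0 subr_gt0.
  (* Five lengths [eps] must fit: four averages, and the ball of radius [eps] around [p] on which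
     [avgs_dist] is used. *)
  exists (Num.min del (r - `|p - x0|) / 5); first by rewrite divr_gt0.
  move=> eps eps0; rewrite ltr_pdivlMr // => eps5.
  have lt5 : eps + eps *+ size (enum 'I_4) < Num.min del (r - `|p - x0|).
    by rewrite size_enum_ord -mulrS -mulr_natr.
  move: lt5; rewrite lt_min => /andP[lt1 lt2].
  apply: (@avgs_dist R eps eps0 _ p eps).
  - move=> y yp; apply: is_Cn_continuous Ca _; rewrite /nball /= -(subrK p y) -addrA.
    by apply: le_lt_trans (ler_normD _ _) _; move: (lt_trans yp lt2); lra.
  - by move=> y yp; apply: Hd; exact: lt_trans yp lt1.
  - by rewrite subrr normr0.
have [d1 d10 H1] := close _ bp; have [d2 d20 H2] := close _ bm.
have m0 : 0 < Num.min (Num.min d1 d2) ((r - (`|x - x0| + D)) / 4).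
  by rewrite !lt_min d10 d20 divr_gt0 // subr_gt0.
(* A quarter of the margin leaves room for four averages around the cube of radius [D]. *)
pose eps := Num.min (Num.min d1 d2) ((r - (`|x - x0| + D)) / 4) / 2.
have eps0 : 0 < eps by rewrite divr_gt0.
have : eps < Num.min (Num.min d1 d2) ((r - (`|x - x0| + D)) / 4).
  by rewrite ltr_pdivrMr // ltr_pMr // ltr1n.
rewrite !lt_min -andbA => /and3P[ed1 ed2 edr].
have {}H1 := H1 _ eps0 ed1; have {}H2 := H2 _ eps0 ed2.
pose r' := r - eps *+ 4.
have rE : r' + eps *+ 4 = r by rewrite /r' subrK.
have r'D : `|x - x0| + D < r'.
  by rewrite /r' -mulr_natr; move: edr; rewrite ltr_pdivlMr //; lra.
have inb' (y : R4) : `|y| <= D -> nball x0 r' (x + y).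
  move=> yD; rewrite /nball /= addrAC.
  by apply: le_lt_trans (ler_normD _ _) _; lra.
have ca : continuous_near x0 (r' + eps *+ size (enum 'I_4)) a.
  by rewrite size_enum_ord rE => y yr; exact: is_Cn_continuous Ca yr.
pose u (y : R4) := avgs eps (enum 'I_4) a (y + x).
have key := @odd_part_bound R u n D M D0 M0 _ _ h hD.
have : u (h *: evec n) - u (- (h *: evec n)) <= 10 * M * h / D.
  apply: key => y yD.
    have yx : nball x0 r' (y + x) by rewrite [y + x]addrC; exact: inb'.
    split; first by apply: continuous_translate; exact: (avgs_continuous eps0 ca yx).
    rewrite /u -[X in `|X|]subr0; apply: (avgs_dist eps0 ca _ yx) => z.
    by rewrite size_enum_ord rE subr0; exact: aM.
  have : asymp_harmonic (avgs eps (enum 'I_4) a) (x + y).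
    apply: (avgs_asymp_harmonic eps0 _ (inb' _ (ltW yD))).
    by rewrite rE; exact: S.
  move=> H e ep; have [del dp Hd] := H _ ep; exists del => // t td.
  have := Hd t td; congr (`|_| <= _); apply: eq_bigr => i _.
  by rewrite /u ![_ + x]addrC !addrA.
rewrite /u [_ + x]addrC [- _ + x]addrC => H3.
move: H1 H2; rewrite !ler_norml => /andP[h1 h2] /andP[h3 h4].
lra.
Qed.

End CauchyRiemann.

(** * Calculus of the classes C^n on open sets *)

Section DifferentiabilityClasses.
Variable R : realType.
Local Notation R4 := 'rV[R]_4.
Local Notation evec := (@evec R).
Implicit Types (U : set R4) (f g : R4 -> R).

Lemma near_open U f g x : open U -> (forall y, U y -> f y = g y) -> U x ->
  \forall y \near x, f y = g y.
Proof. by move=> oU fg Ux; apply: filterS fg _; exact: open_nbhs_nbhs. Qed.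

Lemma continuous_ext_open U f g x : open U -> (forall y, U y -> f y = g y) -> U x ->
  {for x, continuous f} -> {for x, continuous g}.
Proof.
move=> oU fg Ux cf; have : g z @[z --> x] --> g x; last by [].
rewrite -(fg x Ux); apply: cvg_trans cf.
exact: (@near_eq_cvg _ _ (nbhs x) _ f g (near_open oU fg Ux)).
Qed.

Lemma partial_ext U f g i x : open U -> (forall y, U y -> f y = g y) -> U x ->
  partial i f x = partial i g x.
Proof. by move=> oU fg Ux; apply: near_eq_derive; exact: near_open Ux. Qed.

Lemma is_derive_ext U f g (v : R4) (d : R) x : open U -> (forall y, U y -> f y = g y) -> U x ->
  is_derive x v f d -> is_derive x v g d.
Proof. by move=> oU fg Ux; apply: near_eq_is_derive; exact: near_open Ux. Qed.

Lemma partialE i f x d : is_derive x (evec i) f d -> partial i f x = d.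
Proof. by move=> h; exact: (@derive_val _ _ _ _ _ _ _ h). Qed.

(** [partial i f] is a total function that agrees with [df i] only on [U]; the inner claim [ext]
    shows, by induction on the order, that being C^n on an open set depends only on the values
    there. *)
Lemma is_CnS_of n U f (df : 'I_4 -> R4 -> R) : open U ->
  (forall x, U x -> {for x, continuous f}) ->
  (forall i x, U x -> is_derive x (evec i) f (df i x)) ->
  (forall i, is_Cn n U (df i)) -> is_Cn n.+1 U f.
Proof.
move=> oU cf ddf Cdf; split => // i; split; first by move=> x /(ddf i)[].
have ext : forall m h k, (forall y, U y -> h y = k y) -> is_Cn m U h -> is_Cn m U k.
  elim=> [|m IH] h k hk [ch dh].
    by split => // x Ux; apply: (continuous_ext_open oU hk Ux); exact: ch.
  split=> [x Ux|j]; first by apply: (continuous_ext_open oU hk Ux); exact: ch.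
  have [d1 d2] := dh j; split=> [x Ux|].
    by have [] := is_derive_ext oU hk Ux (derivableP (d1 x Ux)).
  by apply: IH d2 => x Ux; exact: partial_ext oU hk Ux.
by apply: ext (Cdf i) => y Uy; rewrite (partialE (ddf i y Uy)).
Qed.

Lemma is_Cn_ext n U f g : open U -> (forall y, U y -> f y = g y) ->
  is_Cn n U f -> is_Cn n U g.
Proof.
move=> oU fg; case: n => [|n] Cf.
  by split => // x Ux; apply: (continuous_ext_open oU fg Ux); exact: is_Cn_continuous Cf Ux.
apply: (is_CnS_of (df := fun i => partial i f)) => // [x Ux|i x Ux|i].
- by apply: (continuous_ext_open oU fg Ux); exact: is_Cn_continuous Cf Ux.
- by apply: (is_derive_ext oU fg Ux); exact: is_Cn_is_derive Cf Ux.
- exact: is_Cn_partial.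
Qed.

Lemma is_Cn_pred n U f : is_Cn n.+1 U f -> is_Cn n U f.
Proof.
elim: n f => [|n IH] f [cf df]; first by split.
by split=> // i; have [d1 d2] := df i; split => //; exact: IH.
Qed.

Lemma is_Cn_subset n U V f : V `<=` U -> is_Cn n U f -> is_Cn n V f.
Proof.
move=> VU; elim: n f => [|n IH] f [cf df]; first by split => // x /VU; exact: cf.
split=> [x /VU|i]; first exact: cf.
by have [d1 d2] := df i; split => [x /VU|]; [exact: d1|exact: IH].
Qed.

Lemma is_Cn_cst n U (k : R) : open U -> is_Cn n U (fun=> k).
Proof.
move=> oU; elim: n k => [|n IH] k; first by split => // x _; exact: cst_continuous.
apply: (is_CnS_of (df := fun _ _ => 0)) => // x _; exact: cst_continuous.
Qed.

Lemma is_CnD n U f g : open U -> is_Cn n U f -> is_Cn n U g ->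
  is_Cn n U (fun x => f x + g x).
Proof.
move=> oU; elim: n f g => [|n IH] f g Cf Cg.
  by split => // x Ux; exact: (cvgD (is_Cn_continuous Cf Ux) (is_Cn_continuous Cg Ux)).
apply: (is_CnS_of (df := fun i x => partial i f x + partial i g x)) => // [x Ux|i x Ux|i].
- exact: (cvgD (is_Cn_continuous Cf Ux) (is_Cn_continuous Cg Ux)).
- exact: (is_deriveD (is_Cn_is_derive i Cf Ux) (is_Cn_is_derive i Cg Ux)).
- by apply: IH; exact: is_Cn_partial.
Qed.

Lemma is_CnM n U f g : open U -> is_Cn n U f -> is_Cn n U g ->
  is_Cn n U (fun x => f x * g x).
Proof.
move=> oU; elim: n f g => [|n IH] f g Cf Cg.
  by split => // x Ux; exact: (cvgM (is_Cn_continuous Cf Ux) (is_Cn_continuous Cg Ux)).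
apply: (is_CnS_of (df := fun i x => f x * partial i g x + g x * partial i f x))
    => // [x Ux|i x Ux|i].
- exact: (cvgM (is_Cn_continuous Cf Ux) (is_Cn_continuous Cg Ux)).
- exact: (is_deriveM (is_Cn_is_derive i Cf Ux) (is_Cn_is_derive i Cg Ux)).
- apply: is_CnD => //.
    exact: IH (is_Cn_pred Cf) (is_Cn_partial i Cg).
  exact: IH (is_Cn_pred Cg) (is_Cn_partial i Cf).
Qed.

Lemma is_CnZ n U (k : R) f : open U -> is_Cn n U f -> is_Cn n U (fun x => k * f x).
Proof. by move=> oU Cf; apply: is_CnM => //; exact: is_Cn_cst. Qed.

Lemma is_CnN n U f : open U -> is_Cn n U f -> is_Cn n U (fun x => - f x).
Proof.
move=> oU /(is_CnZ (-1) oU); apply: is_Cn_ext => // y _; exact: mulN1r.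
Qed.

Lemma is_derive_coord (x : R4) i j :
  is_derive x (evec i) (fun y : R4 => y 0 j) (j == i)%:R.
Proof.
apply/is_deriveP => eta e0; exists 1 => // t t0 _.
by rewrite !mxE eqxx /= addrAC subrr add0r mulrA mulVf // mul1r subrr normr0 ltW.
Qed.

Lemma is_Cn_coord n U j : open U -> is_Cn n U (fun y : R4 => y 0 j).
Proof.
move=> oU; case: n => [|n]; first by split => // x _; exact: coord_continuous.
apply: (is_CnS_of (df := fun i _ => (j == i)%:R)) => // [x _|i x _|i].
- exact: coord_continuous.
- exact: is_derive_coord.
- exact: is_Cn_cst.
Qed.

Lemma partial_translate f v i x :
  partial i (fun z : R4 => f (z + v)) x = partial i f (x + v).
Proof.
rewrite /partial /derive; congr (lim (_ @ 0^')).
by apply/funext => h /=; rewrite addrA.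
Qed.

Lemma is_Cn_translate n U f v : is_Cn n U f ->
  is_Cn n [set y | U (y + v)] (fun z : R4 => f (z + v)).
Proof.
elim: n f => [|n IH] f [cf df].
  by split => // x Ux; apply: continuous_translate; exact: cf.
split=> [x Ux|i]; first by apply: continuous_translate; exact: cf.
have [d1 d2] := df i; split=> [x Ux|].
  by have [] := is_derive_translate (derivableP (d1 _ Ux)).
have -> : partial i (fun z : R4 => f (z + v)) = (fun z => partial i f (z + v)).
  by apply/funext => z; exact: partial_translate.
exact: IH.
Qed.

Lemma open_nball (x0 : R4) r : open (nball x0 r).
Proof.
apply: (@open_comp _ _ (fun y : R4 => `|y - x0|) [set u | u < r]); last exact: open_lt.
move=> y _; apply: (@continuous_comp _ _ _ (fun y : R4 => y - x0) Num.norm).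
  exact: (cvgB cvg_id (cvg_cst x0)).
exact: norm_continuous.
Qed.

End DifferentiabilityClasses.

(** * Second derivatives from estimates on difference quotients *)

Section CauchyRiemannRegularity.
Variable R : realType.
Local Notation R4 := 'rV[R]_4.
Local Notation evec := (@evec R).
Implicit Types (U : set R4) (a b c d : R4 -> R).

Lemma CR_subset U V a b c d : V `<=` U -> CR_system U a b c d -> CR_system V a b c d.
Proof.
move=> VU [[Ca Cb Cc Cd] eqs]; split; last by move=> x /VU; exact: eqs.
by split; exact: is_Cn_subset VU _.
Qed.

Lemma is_derive_comb2 (f g : R4 -> R) (x e : R4) (k l df dg : R) :
  is_derive x e f df -> is_derive x e g dg ->
  is_derive x e (fun z => k * f z + l * g z) (k * df + l * dg).
Proof. by move=> hf hg; exact: (is_deriveD (is_deriveZ k hf) (is_deriveZ l hg)). Qed.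

Lemma is_Cn_comb2 n U (k l : R) a b : open U -> is_Cn n U a -> is_Cn n U b ->
  is_Cn n U (fun x => k * a x + l * b x).
Proof. by move=> oU Ca Cb; apply: is_CnD => //; exact: is_CnZ. Qed.

Lemma CR_comb2 U (k l : R) a b c d a' b' c' d' : open U ->
  CR_system U a b c d -> CR_system U a' b' c' d' ->
  CR_system U (fun x => k * a x + l * a' x) (fun x => k * b x + l * b' x)
    (fun x => k * c x + l * c' x) (fun x => k * d x + l * d' x).
Proof.
move=> oU [[Ca Cb Cc Cd] eqs] [[Ca' Cb' Cc' Cd'] eqs'].
split; first by split; exact: is_Cn_comb2.
move=> x Ux.
have pE i f g : is_Cn 1 U f -> is_Cn 1 U g ->
    partial i (fun x => k * f x + l * g x) x = k * partial i f x + l * partial i g x.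
  move=> Cf Cg; apply: partialE.
  exact: (is_derive_comb2 k l (is_Cn_is_derive i Cf Ux) (is_Cn_is_derive i Cg Ux)).
rewrite !pE //; have [e1 e2 e3 e4] := eqs x Ux; have [e1' e2' e3' e4'] := eqs' x Ux.
have lin0 (X Y Z : R) : X = 0 -> Y = 0 -> Z = k * X + l * Y -> Z = 0.
  by move=> -> -> ->; rewrite !mulr0 addr0.
clear -e1 e2 e3 e4 e1' e2' e3' e4' lin0.
pose s (f : R4 -> R) i := partial i f x; rewrite -!/(s _ _) in e1 e2 e3 e4 e1' e2' e3' e4' *.
move: s e1 e2 e3 e4 e1' e2' e3' e4' => s.
move: (s a) (s b) (s c) (s d) (s a') (s b') (s c') (s d').
move=> {s a b c d a' b' c' d'} a b c d a' b' c' d'.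
move: (a 0) (a 1) (a 2) (a 3) (b 0) (b 1) (b 2) (b 3) => {a b} a0 a1 a2 a3 b0 b1 b2 b3.
move: (c 0) (c 1) (c 2) (c 3) (d 0) (d 1) (d 2) (d 3) => {c d} c0 c1 c2 c3 d0 d1 d2 d3.
move: (a' 0) (a' 1) (a' 2) (a' 3) (b' 0) (b' 1) (b' 2) (b' 3) => {a' b'} p0 p1 p2 p3 q0 q1 q2 q3.
move: (c' 0) (c' 1) (c' 2) (c' 3) (d' 0) (d' 1) (d' 2) (d' 3) => {c' d'} r0 r1 r2 r3 t0 t1 t2 t3.
move=> e1 e2 e3 e4 e1' e2' e3' e4'.
by split; [apply: lin0 e1 e1' _|apply: lin0 e2 e2' _|apply: lin0 e3 e3' _|
  apply: lin0 e4 e4' _]; ring.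
Qed.

Lemma CR_translate U a b c d v : CR_system U a b c d ->
  CR_system [set y | U (y + v)] (fun z : R4 => a (z + v)) (fun z : R4 => b (z + v))
    (fun z : R4 => c (z + v)) (fun z : R4 => d (z + v)).
Proof.
move=> [[Ca Cb Cc Cd] eqs]; split; first by split; exact: is_Cn_translate.
by move=> x Ux; rewrite !partial_translate; exact: eqs.
Qed.

(** The system is linear with constant coefficients, hence stable under translations and real
    combinations; the translation costs [|h|] of the radius. *)
Lemma CR_diffq (x0 : R4) r r' a b c d i (h : R) : CR_system (nball x0 r) a b c d ->
  r' + `|h| <= r ->
  CR_system (nball x0 r') (diffq h i a) (diffq h i b) (diffq h i c) (diffq h i d).
Proof.
move=> S hr.
have S1 : CR_system (nball x0 r') a b c d.
  apply: CR_subset S => y yr; apply: lt_le_trans yr _; apply: le_trans hr.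
  by rewrite lerDl.
have S2 := CR_translate (h *: evec i) S.
have {}S2 := CR_subset (V := nball x0 r') _ S2.
have dE f : diffq h i f = (fun x => h^-1 * f (x + h *: evec i) + (- h^-1) * f x).
  by apply/funext => y; rewrite /diffq; ring.
rewrite !dE; apply: CR_comb2 S1; first exact: open_nball.
apply: S2 => y yr; have := nball_step h i yr; rewrite /nball /= => yr'.
exact: lt_le_trans yr' hr.
Qed.

(* Multiplication of the complex pair [(a + i b, c + i d)] by [- i]. *)
Lemma CR_mulNi U a b c d : open U -> CR_system U a b c d ->
  CR_system U b (fun x => - a x) d (fun x => - c x).
Proof.
move=> oU [[Ca Cb Cc Cd] eqs]; split.
  by split; [exact: Cb|exact: is_CnN|exact: Cd|exact: is_CnN].
move=> x Ux.
have pN i f : is_Cn 1 U f -> partial i (fun x => - f x) x = - partial i f x.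
  by move=> Cf; apply: partialE; exact: (is_deriveN (is_Cn_is_derive i Cf Ux)).
rewrite !pN //; have [e1 e2 e3 e4] := eqs x Ux.
split; rewrite ?opprK; [exact: e2| |exact: e4|].
- by apply: oppr_inj; rewrite oppr0 -[RHS]e1 !opprD !opprK.
- by apply: oppr_inj; rewrite oppr0 -[RHS]e3 !opprD !opprK.
Qed.

(* The quaternionic structure [(f_0', f_1') |-> (conj f_1', - conj f_0')]. *)
Lemma CR_conj U a b c d : open U -> CR_system U a b c d ->
  CR_system U c (fun x => - d x) (fun x => - a x) b.
Proof.
move=> oU [[Ca Cb Cc Cd] eqs]; split.
  by split; [exact: Cc|exact: is_CnN|exact: is_CnN|exact: Cb].
move=> x Ux.
have pN i f : is_Cn 1 U f -> partial i (fun x => - f x) x = - partial i f x.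
  by move=> Cf; apply: partialE; exact: (is_deriveN (is_Cn_is_derive i Cf Ux)).
rewrite !pN //; have [e1 e2 e3 e4] := eqs x Ux.
split; rewrite -addrA addrC addrA ?opprK; [|exact: e4|exact: e1|].
- by apply: oppr_inj; rewrite oppr0 -[RHS]e3 !opprD !opprK.
- by apply: oppr_inj; rewrite oppr0 -[RHS]e2 !opprD !opprK.
Qed.

(** This is multiplication by [- i] done twice. *)
Lemma CR_opp U a b c d : open U -> CR_system U a b c d ->
  CR_system U (fun x => - a x) (fun x => - b x) (fun x => - c x) (fun x => - d x).
Proof.
move=> oU S; have := CR_mulNi oU (CR_mulNi oU S).
by [].
Qed.

(** The symmetric estimate is used at the midpoint of the step, with half step [|t| / 2] and cube
    radius [r / 4], whence the factor 20; applied to [- a] as well, it becomes two-sided. *)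
Lemma CR_step_le (x0 : R4) r M a b c d j (t : R) y :
  CR_system (nball x0 r) a b c d -> 0 < M -> (forall y, nball x0 r y -> `|a y| <= M) ->
  nball x0 (r / 2) y -> `|t| <= r / 8 ->
  `|a (y + t *: evec j) - a y| <= 20 * M / r * `|t|.
Proof.
move=> S M0 aM yr tr.
have r0 : 0 < r by have := le_lt_trans (normr_ge0 _) yr; lra.
have SN := CR_opp (@open_nball _ _ _) S.
have aMN z : nball x0 r z -> `|- a z| <= M by rewrite normrN; exact: aM.
pose x : R4 := y + (t / 2) *: evec j.
have xr : `|x - x0| + r / 4 < r.
  have := nball_step (t / 2) j yr; rewrite /nball /= normrM [`|2^-1|]ger0_norm //.
  by rewrite -/x => h; lra.
have D0 : 0 < r / 4 by rewrite divr_gt0.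
have hh : 0 <= `|t| / 2 <= r / 4 by apply/andP; split; have := normr_ge0 t; lra.
have h1 := CR_difference_le j S M0 aM D0 xr hh.
have h2 := CR_difference_le j SN M0 aMN D0 xr hh.
have E : 10 * M * (`|t| / 2) / (r / 4) = 20 * M / r * `|t|.
  by field; rewrite gt_eqF.
rewrite E in h1 h2.
have xp : x + (t / 2) *: evec j = y + t *: evec j.
  by rewrite /x -addrA -scalerDl -splitr.
have xm : x - (t / 2) *: evec j = y by rewrite /x addrK.
have [t0|t0] := leP 0 t.
  move: h1 h2; rewrite (ger0_norm t0) xp xm => h1 h2.
  by rewrite ler_norml; apply/andP; split; lra.
move: h1 h2; rewrite (ltr0_norm t0) mulNr scaleNr opprK xp xm => h1 h2.
by rewrite ler_norml; apply/andP; split; lra.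
Qed.

Lemma diffq_cvg a (y : R4) i (da eta : R) : is_derive y (evec i) a da -> 0 < eta ->
  exists2 del, 0 < del & forall h, h != 0 -> `|h| < del -> `|diffq h i a y - da| <= eta.
Proof. by move=> /is_deriveP H e0; exact: H. Qed.

(* Difference quotients of [a] belong to solutions of the same system, so that
   [CR_step_le] can be iterated: it bounds them, then makes them Lipschitz, then
   controls the increments of the difference of two of them. *)
Lemma CR_second_diff (x0 : R4) r a b c d : 0 < r -> CR_system (nball x0 r) a b c d ->
  exists2 rho, 0 < rho <= r / 2 & exists2 K, 0 <= K &
  forall i j (y : R4) (h t : R), nball x0 rho y -> h != 0 -> `|h| < rho -> `|t| < rho ->
    `|(diffq h i a (y + t *: evec j) - partial i a (y + t *: evec j))
      - (diffq h i a y - partial i a y)| <= K * `|h| * `|t|.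
Proof.
move=> r0 S; have [[Ca _ _ _] _] := S.
have x0r : nball x0 r x0 by rewrite /nball /= subrr normr0.
have [del d0 Hd] := (continuous_forP _ _).1 (is_Cn_continuous Ca x0r) _ ltr01.
pose r1 := Num.min r del; pose M := `|a x0| + 1.
have r10 : 0 < r1 by rewrite lt_min r0.
have r1r : r1 <= r by rewrite ge_min lexx.
have M0 : 0 < M by rewrite ltr_wpDl.
have aM y : nball x0 r1 y -> `|a y| <= M.
  rewrite /nball /= lt_min => /andP[_ /Hd h]; rewrite -(subrK (a x0) (a y)).
  by apply: le_trans (ler_normD _ _) _; rewrite /M addrC lerD2l.
have sub (s s' : R) : s <= s' -> nball x0 s `<=` nball x0 s'.
  by move=> ss y yr; exact: lt_le_trans yr ss.
have {}S : CR_system (nball x0 r1) a b c d by apply: CR_subset S; exact: sub.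
have {}Ca : is_Cn 1 (nball x0 r1) a by case: S => [[]].
(* One constant per application of [CR_step_le], namely 20 times the current bound over the current
   radius, which is halved each time. *)
pose K1 := 20 * M / r1; pose K2 := 20 * K1 / (r1 / 2); pose K3 := 20 * K2 / (r1 / 2 / 2).
have K10 : 0 < K1 by rewrite divr_gt0 // mulr_gt0.
have K20 : 0 < K2 by rewrite !divr_gt0 // mulr_gt0.
have K30 : 0 < K3 by rewrite !divr_gt0 // mulr_gt0.
have b1 i h y : h != 0 -> `|h| <= r1 / 8 -> nball x0 (r1 / 2) y -> `|diffq h i a y| <= K1.
  move=> h0 hr yr; rewrite /diffq normrM normfV ler_pdivrMl ?normr_gt0 // [leRHS]mulrC.
  exact: CR_step_le S M0 aM yr hr.
have S2 i h : `|h| <= r1 / 8 -> CR_system (nball x0 (r1 / 2)) (diffq h i a) (diffq h i b)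
    (diffq h i c) (diffq h i d).
  by move=> hr; apply: CR_diffq S _; lra.
have b2 i j h y t : h != 0 -> `|h| <= r1 / 8 -> nball x0 (r1 / 2 / 2) y ->
    `|t| <= r1 / 2 / 8 -> `|diffq h i a (y + t *: evec j) - diffq h i a y| <= K2 * `|t|.
  move=> h0 hr yr tr; apply: CR_step_le (S2 i h hr) K10 _ yr tr => z.
  exact: b1.
have dv i y : nball x0 r1 y -> is_derive y (evec i) a (partial i a y).
  by move=> yr; exact: is_Cn_is_derive Ca yr.
have inr y j (t : R) : nball x0 (r1 / 2 / 2) y -> `|t| <= r1 / 2 / 8 ->
    nball x0 r1 (y + t *: evec j).
  by move=> yr tr; apply: sub (nball_step t j yr); lra.
(* The Lipschitz bound on the quotients passes to their limit. *)
have b3 i y t : nball x0 (r1 / 2 / 2) y -> `|t| <= r1 / 2 / 8 ->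
    `|partial i a (y + t *: evec i) - partial i a y| <= K2 * `|t|.
  move=> yr tr; apply/ler_addgt0Pr => eta e0.
  have e2 : 0 < eta / 2 by rewrite divr_gt0.
  have yr1 : nball x0 r1 y by apply: sub yr; lra.
  have [d1 d10 H1] := diffq_cvg (dv i _ yr1) e2.
  have [d2 d20 H2] := diffq_cvg (dv i _ (inr y i t yr tr)) e2.
  pose h := Num.min (Num.min d1 d2) (r1 / 8) / 2.
  have m0 : 0 < Num.min (Num.min d1 d2) (r1 / 8) by rewrite !lt_min d10 d20 divr_gt0.
  have h0 : 0 < h by rewrite divr_gt0.
  have : `|h| < Num.min (Num.min d1 d2) (r1 / 8).
    by rewrite gtr0_norm // ltr_pdivrMr // ltr_pMr // ltr1n.
  rewrite !lt_min -andbA => /and3P[hd1 hd2 hr].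
  have hn : h != 0 by rewrite gt_eqF.
  have := H1 h hn hd1; have := H2 h hn hd2; have := b2 i i h y t hn (ltW hr) yr tr.
  by rewrite !ler_norml => /andP[u1 u2] /andP[v1 v2] /andP[w1 w2]; apply/andP; split; lra.
(* The quotient is a nearby value of [partial i a] by the mean value theorem, so [b3] yields a rate
   of convergence. *)
have b4 i h y : h != 0 -> `|h| <= r1 / 2 / 8 -> nball x0 (r1 / 2 / 2) y ->
    `|diffq h i a y - partial i a y| <= K2 * `|h|.
  move=> h0 hr yr; have [|e eh E] := @MVT_line R a (partial i a) y (evec i) h.
    by move=> s sh; apply: dv; apply: inr yr _; exact: le_trans sh hr.
  rewrite /diffq E mulrA mulVf // mul1r.
  by apply: le_trans (b3 i y e yr (le_trans eh hr)) _; rewrite ler_pM2l.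
(* This is [(r1 / 4) / 8], the longest step that [CR_step_le] allows on the third ball, of radius
   [r1 / 4]. *)
exists (r1 / 32); first by apply/andP; split; lra.
exists K3; first exact: ltW.
move=> i j y h t yr h0 hr tr.
have hr' : `|h| <= r1 / 2 / 8 by lra.
have yr2 : nball x0 (r1 / 2 / 2) y by apply: sub yr; lra.
have yr3 : nball x0 (r1 / 2 / 2 / 2) y by apply: sub yr; lra.
have tr2 : `|t| <= r1 / 2 / 8 by lra.
have tr3 : `|t| <= r1 / 2 / 2 / 8 by lra.
(* By [b4] the difference of two quotients is a solution of size at most [K2 * (|h| + |h'|)], and
   the third application bounds its increments. *)
have b5 h' : h' != 0 -> `|h'| <= r1 / 2 / 8 ->
    `|(diffq h i a (y + t *: evec j) - diffq h' i a (y + t *: evec j))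
      - (diffq h i a y - diffq h' i a y)| <= K3 * (`|h| + `|h'|) * `|t|.
  move=> h'0 h'r.
  have S3 k : `|k| <= r1 / 2 / 8 -> CR_system (nball x0 (r1 / 2 / 2)) (diffq k i a)
      (diffq k i b) (diffq k i c) (diffq k i d).
    move=> kr; apply: (CR_subset (U := nball x0 (r1 / 2))); first by apply: sub; lra.
    by apply: S2; lra.
  have Sp := CR_comb2 1 (-1) (@open_nball _ x0 _) (S3 h hr') (S3 h' h'r).
  have hh0 : 0 < `|h| + `|h'| by rewrite ltr_wpDr // normr_gt0.
  have Kh0 : 0 < K2 * (`|h| + `|h'|) by rewrite mulr_gt0.
  have pb z : nball x0 (r1 / 2 / 2) z ->
      `|1 * diffq h i a z + (-1) * diffq h' i a z| <= K2 * (`|h| + `|h'|).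
    move=> zr; have u := b4 i h z h0 hr' zr; have v := b4 i h' z h'0 h'r zr.
    have -> : 1 * diffq h i a z + (-1) * diffq h' i a z =
      (diffq h i a z - partial i a z) - (diffq h' i a z - partial i a z) by ring.
    by apply: le_trans (ler_normB _ _) _; rewrite mulrDr; exact: lerD.
  have := CR_step_le j Sp Kh0 pb yr3 tr3.
  rewrite /K3 !mul1r !mulN1r.
  have -> : 20 * (K2 * (`|h| + `|h'|)) / (r1 / 2 / 2) * `|t| =
    20 * K2 / (r1 / 2 / 2) * (`|h| + `|h'|) * `|t| by field; rewrite gt_eqF.
  by [].
(* In [b5] the step [h'] now tends to 0, which turns the second quotient into [partial i a]. *)
apply/ler_addgt0Pr => eta e0.
have e3 : 0 < eta / 3 by rewrite divr_gt0.
have yr1 : nball x0 r1 y by apply: sub yr; lra.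
have [d1 d10 H1] := diffq_cvg (dv i _ yr1) e3.
have [d2 d20 H2] := diffq_cvg (dv i _ (inr y j t yr2 tr2)) e3.
have kt0 : 0 < K3 * `|t| + 1 by rewrite ltr_wpDl // mulr_ge0 // ltW.
pose m := Num.min (Num.min d1 d2) (Num.min (r1 / 2 / 8) (eta / 3 / (K3 * `|t| + 1))).
have m0 : 0 < m by rewrite !lt_min d10 d20 !divr_gt0.
pose h' := m / 2.
have h'0 : 0 < h' by rewrite divr_gt0.
have : `|h'| < m by rewrite gtr0_norm // ltr_pdivrMr // ltr_pMr // ltr1n.
rewrite !lt_min -andbA => /and4P[hd1 hd2 hd3 hd4].
have h'n : h' != 0 by rewrite gt_eqF.
rewrite ltr_pdivlMr // in hd4.
have u1 := H1 h' h'n hd1; have u2 := H2 h' h'n hd2; have u3 := b5 h' h'n (ltW hd3).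
have n1 := normr_ge0 h'.
have u4 : K3 * (`|h| + `|h'|) * `|t| <= K3 * `|h| * `|t| + eta / 3.
  rewrite mulrDr mulrDl lerD2l; apply: le_trans (ltW hd4).
  by rewrite mulrDr mulr1 [K3 * _]mulrC -mulrA lerDl.
move: u1 u2; have {u3} := le_trans u3 u4; rewrite !ler_norml.
by move=> /andP[? ?] /andP[? ?] /andP[? ?]; apply/andP; split; lra.
Qed.

(** The hypothesis is a Cauchy condition on the quotients; letting [h'] tend to 0 in it preserves
    the rate. *)
Lemma is_derive_of_cauchy (f : R4 -> R) (y : R4) i (rho K : R) : 0 < rho -> 0 <= K ->
  (forall h h' : R, h != 0 -> h' != 0 -> `|h| < rho -> `|h'| < rho ->
     `|diffq h i f y - diffq h' i f y| <= K * (`|h| + `|h'|)) ->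
  exists2 g, is_derive y (evec i) f g &
    forall h, h != 0 -> `|h| < rho -> `|diffq h i f y - g| <= K * `|h|.
Proof.
move=> rho0 K0 H.
have K10 : 0 < K + 1 by rewrite ltr_wpDl.
have near0 (del : R) : 0 < del -> \forall h \near (0 : R)^', h != 0 /\ `|h| < del.
  move=> d0; near=> h; split; first by near: h; exact: nbhs_dnbhs_neq.
  by near: h; exact: dnbhs0_lt.
have : cvg (diffq h i f y @[h --> (0 : R)^']).
  apply/cauchy_cvgP/cauchy_exP => eta e0 /=.
  pose h0 := Num.min rho (eta / (K + 1) / 2) / 2.
  have m0 : 0 < Num.min rho (eta / (K + 1) / 2) by rewrite lt_min rho0 !divr_gt0.
  have h00 : 0 < h0 by rewrite divr_gt0.
  have : `|h0| < Num.min rho (eta / (K + 1) / 2).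
    by rewrite gtr0_norm // ltr_pdivrMr // ltr_pMr // ltr1n.
  rewrite lt_min => /andP[h0r h0e].
  exists (diffq h0 i f y).
  have nh : \forall h \near (0 : R)^', h != 0 /\ `|h| < Num.min rho (eta / (K + 1) / 2).
    exact: near0.
  apply: filterS nh => h [hn].
  rewrite lt_min => /andP[hr he]; rewrite -ball_normE /ball_ /=.
  apply: le_lt_trans (H _ _ _ hn h0r hr) _; first by rewrite gt_eqF.
  apply: le_lt_trans (_ : _ <= (K + 1) * (`|h0| + `|h|)) _.
    by rewrite ler_wpM2r ?addr_ge0 // lerDl.
  by rewrite mulrC -ltr_pdivlMr //; lra.
move=> /cvg_ex[g Hg]; exists g.
  apply/is_deriveP => eta e0; move/cvgrPdist_le : Hg => /(_ eta e0).
  move=> /nbhs_normP[del /= d0 Hd]; exists del => // t t0 td.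
  by rewrite distrC; apply: Hd => //=; rewrite sub0r normrN.
move=> h hn hr; apply/ler_addgt0Pr => eta e0.
have e2 : 0 < eta / 2 by rewrite divr_gt0.
have m0 : 0 < Num.min rho (eta / 2 / (K + 1)) by rewrite lt_min rho0 !divr_gt0.
near (0 : R)^' => h'.
have [h'n] : h' != 0 /\ `|h'| < Num.min rho (eta / 2 / (K + 1)).
  by near: h'; exact: near0.
rewrite lt_min => /andP[h'r]; rewrite ltr_pdivlMr // => h'e.
have h1 : `|g - diffq h' i f y| <= eta / 2.
  by near: h'; move/cvgrPdist_le : Hg; exact.
have h2 := H h h' hn h'n hr h'r.
have -> : diffq h i f y - g = (diffq h i f y - diffq h' i f y) - (g - diffq h' i f y) by ring.
apply: le_trans (ler_normB _ _) _.
have n1 := normr_ge0 h'; move: h2; rewrite mulrDr => h2.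
have : K * `|h'| <= eta / 2 by apply: le_trans (ltW h'e); rewrite mulrDr mulr1 mulrC lerDl.
by lra.
Unshelve. all: by end_near.
Qed.

Lemma CR_partial_is_derive (x0 : R4) r a b c d : 0 < r -> CR_system (nball x0 r) a b c d ->
  exists2 rho, 0 < rho & exists G : 'I_4 -> 'I_4 -> R4 -> R, forall i j (y : R4),
    nball x0 rho y ->
    [/\ is_derive y (evec j) (partial i a) (G i j y), {for y, continuous (G i j)}
      & G i j y = G j i y].
Proof.
move=> r0 S; have [[Ca _ _ _] _] := S.
have [rho /andP[rho0 rhor] [K K0 key]] := CR_second_diff r0 S.
have da i y : nball x0 r y -> is_derive y (evec i) a (partial i a y).
  by move=> yr; exact: is_Cn_is_derive Ca yr.
have inr (y : R4) : nball x0 rho y -> nball x0 r y.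
  by move=> yr; apply: lt_le_trans yr _; lra.
have inr2 (y : R4) j (h : R) : nball x0 rho y -> `|h| < rho -> nball x0 r (y + h *: evec j).
  by move=> yr hr; have := nball_step h j yr; rewrite /nball /=; lra.
(* The difference quotients of [partial i a] in direction [j] and of
   [partial j a] in direction [i] are both close to the mixed second difference
   quotient of [a]. *)
have key2 i j y h t : nball x0 rho y -> h != 0 -> t != 0 -> `|h| < rho -> `|t| < rho ->
    `|diffq h i (partial j a) y - diffq t j (partial i a) y| <= K * (`|h| + `|t|).
  move=> yr h0 t0 hr tr; have k1 := key i j y h t yr h0 hr tr.
  have k2 := key j i y t h yr t0 tr hr.
  have ht0 : 0 < `|h| * `|t| by rewrite mulr_gt0 // normr_gt0.
  rewrite -(ler_pM2l ht0) -[X in X * `|_ - _|]normrM -normrM.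
  pose p := (diffq h i a (y + t *: evec j) - partial i a (y + t *: evec j))
      - (diffq h i a y - partial i a y).
  pose q := (diffq t j a (y + h *: evec i) - partial j a (y + h *: evec i))
      - (diffq t j a y - partial j a y).
  have -> : h * t * (diffq h i (partial j a) y - diffq t j (partial i a) y) = h * p - t * q.
    rewrite /p /q /diffq [y + h *: _ + _]addrAC; field.
    by rewrite h0 t0.
  apply: (le_trans (ler_normB (h * p) (t * q))); rewrite !normrM.
  have -> : `|h| * `|t| * (K * (`|h| + `|t|)) =
    `|h| * (K * `|h| * `|t|) + `|t| * (K * `|t| * `|h|) by ring.
  by apply: lerD; rewrite ler_wpM2l.
(* Both quotients are compared, through [key2], with the same [diffq t j (partial i a) y]; the
   contribution [2 K |t|] is then made arbitrarily small. *)
have key3 i j y (h h' : R) : nball x0 rho y -> h != 0 -> h' != 0 -> `|h| < rho ->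
    `|h'| < rho ->
    `|diffq h i (partial j a) y - diffq h' i (partial j a) y| <= K * (`|h| + `|h'|).
  move=> yr h0 h'0 hr h'r; apply/ler_addgt0Pr => eta e0.
  have K10 : 0 < 2 * K + 1 by rewrite ltr_wpDl // mulr_ge0.
  have m0 : 0 < Num.min rho (eta / (2 * K + 1)) by rewrite lt_min rho0 divr_gt0.
  pose t := Num.min rho (eta / (2 * K + 1)) / 2.
  have t0 : 0 < t by rewrite divr_gt0.
  have : `|t| < Num.min rho (eta / (2 * K + 1)).
    by rewrite gtr0_norm // ltr_pdivrMr // ltr_pMr // ltr1n.
  rewrite lt_min => /andP[tr]; rewrite ltr_pdivlMr // => te.
  have tn : t != 0 by rewrite gt_eqF.
  have u := key2 i j y h t yr h0 tn hr tr; have v := key2 i j y h' t yr h'0 tn h'r tr.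
  rewrite -(subrKA (diffq t j (partial i a) y)) -[X in `|_ + X|]opprB.
  apply: le_trans (ler_normB _ _) _; have n1 := normr_ge0 t.
  move: u v te; rewrite !mulrDr => u v te; lra.
(* Outside the ball the value 0 is a dummy, so that [choice] can produce a total function. *)
have ex j i (y : R4) : exists g, nball x0 rho y ->
    is_derive y (evec i) (partial j a) g /\
    forall h, h != 0 -> `|h| < rho -> `|diffq h i (partial j a) y - g| <= K * `|h|.
  have [yr|yr] := pselect (nball x0 rho y); last by exists 0.
  have [g dg Hg] := is_derive_of_cauchy rho0 K0 (fun h h' => @key3 i j y h h' yr).
  by exists g.
have {ex} /choice[G HG] : forall jiy : 'I_4 * 'I_4 * R4, exists g, nball x0 rho jiy.2 ->
    is_derive jiy.2 (evec jiy.1.2) (partial jiy.1.1 a) g /\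
    forall h, h != 0 -> `|h| < rho ->
      `|diffq h jiy.1.2 (partial jiy.1.1 a) jiy.2 - g| <= K * `|h|.
  by move=> [[j i] y]; exact: ex.
exists rho => //; exists (fun i j y => G (i, j, y)) => i j y yr.
have [dg Hg] := HG (i, j, y) yr; have [dg' Hg'] := HG (j, i, y) yr; split => //=.
(* [G] is approximated by continuous difference quotients with an error [K * |h|] that is uniform
   over the ball. *)
- apply/continuous_forP => eta e0.
  have K10 : 0 < 3 * (K + 1) by rewrite mulr_gt0 // ltr_wpDl.
  have m0 : 0 < Num.min rho (eta / (3 * (K + 1))) by rewrite lt_min rho0 divr_gt0.
  pose h := Num.min rho (eta / (3 * (K + 1))) / 2.
  have h0 : 0 < h by rewrite divr_gt0.
  have : `|h| < Num.min rho (eta / (3 * (K + 1))).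
    by rewrite gtr0_norm // ltr_pdivrMr // ltr_pMr // ltr1n.
  rewrite lt_min => /andP[hr]; rewrite ltr_pdivlMr // => he.
  have hn : h != 0 by rewrite gt_eqF.
  have cd : {for y, continuous (diffq h j (partial i a))}.
    have c1 : {for y, continuous (fun z : R4 => partial i a (z + h *: evec j))}.
      by apply: continuous_translate; apply: is_C1_partial_continuous Ca _; exact: inr2.
    have c2 : {for y, continuous (partial i a)}.
      by apply: is_C1_partial_continuous Ca _; exact: inr.
    exact: (cvgM (cvg_cst h^-1) (cvgB c1 c2)).
  have e3 : 0 < eta / 3 by rewrite divr_gt0.
  have [del d0 Hd] := (continuous_forP _ _).1 cd _ e3.
  exists (Num.min del (rho - `|y - x0|)); first by rewrite lt_min d0 subr_gt0.
  move=> z; rewrite lt_min => /andP[zd zr].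
  have zr' : nball x0 rho z.
    rewrite /nball /= -(subrK y z) -addrA; apply: le_lt_trans (ler_normD _ _) _.
    by rewrite -ltrBrDr.
  have [_ Hz] := HG (i, j, z) zr'; have u1 := Hz h hn hr; have u2 := Hg h hn hr.
  have u3 := Hd z zd; rewrite /= in u1 u2; have n1 := normr_ge0 h.
  have Kh : K * `|h| <= eta / 3 by move: he; rewrite mulrCA mulrDr mulr1 [_ * K]mulrC; lra.
  move: (le_trans u1 Kh) (le_trans u2 Kh) u3; rewrite !ler_norml; clear.
  move: (diffq h j _ z) (diffq h j _ y) (G _) (G _) => p q g g'.
  by move=> /andP[? ?] /andP[? ?] /andP[? ?]; apply/andP; split; lra.
(* Equal steps in [key2] cost [2 K |h|], and passing to each of the two limits costs [K |h|]; hence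
   the factor 4. *)
- apply/eqP; rewrite -subr_eq0 -normr_le0; apply/ler_addgt0Pr => eta e0; rewrite add0r.
  have K10 : 0 < 4 * K + 1 by rewrite ltr_wpDl // mulr_ge0.
  have m0 : 0 < Num.min rho (eta / (4 * K + 1)) by rewrite lt_min rho0 divr_gt0.
  pose h := Num.min rho (eta / (4 * K + 1)) / 2.
  have h0 : 0 < h by rewrite divr_gt0.
  have : `|h| < Num.min rho (eta / (4 * K + 1)).
    by rewrite gtr0_norm // ltr_pdivrMr // ltr_pMr // ltr1n.
  rewrite lt_min => /andP[hr]; rewrite ltr_pdivlMr // => he.
  have hn : h != 0 by rewrite gt_eqF.
  have u1 := Hg h hn hr; have u2 := Hg' h hn hr; have u3 := key2 i j y h h yr hn hn hr hr.
  have n1 := normr_ge0 h; rewrite /= in u1 u2.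
  have Kh : 4 * (K * `|h|) <= eta by move: he; rewrite mulrDr mulr1 mulrC -mulrA; lra.
  move: u3; rewrite mulrDr => u3.
  rewrite ler_norml in u1; rewrite ler_norml in u2; rewrite ler_norml in u3.
  move: u1 u2 u3 Kh; rewrite ler_norml; clear.
  move: (diffq h j _ y) (diffq h i _ y) (G _) (G _) (K * `|h|) => p q g g' k.
  by move=> /andP[? ?] /andP[? ?] /andP[? ?] ?; apply/andP; split; lra.
Qed.

(** Both claims are local, so [CR_partial_is_derive] is applied in a ball around each point. *)
Lemma CR_C2 U a b c d : open U -> CR_system U a b c d ->
  is_Cn 2 U a /\ forall x, U x -> forall i j,
    partial i (partial j a) x = partial j (partial i a) x.
Proof.
move=> oU S; have [[Ca _ _ _] _] := S.
have loc x : U x -> exists2 rho, 0 < rho & exists G : 'I_4 -> 'I_4 -> R4 -> R,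
    forall i j (y : R4), nball x rho y ->
    [/\ is_derive y (evec j) (partial i a) (G i j y), {for y, continuous (G i j)}
      & G i j y = G j i y].
  move=> Ux; have /nbhs_normP[r /= r0 xr] := open_nbhs_nbhs (conj oU Ux).
  apply: (CR_partial_is_derive r0 (b := b) (c := c) (d := d)); apply: CR_subset S.
  by move=> y yr; apply: xr; rewrite /= distrC.
split; last first.
  move=> x Ux i j; have [rho rho0 [G HG]] := loc x Ux.
  have xr : nball x rho x by rewrite /nball /= subrr normr0.
  have [d1 _ e1] := HG i j x xr; have [d2 _ e2] := HG j i x xr.
  by rewrite (partialE d1) (partialE d2).
split=> [x Ux|i]; first exact: is_Cn_continuous Ca Ux.
split=> [x Ux|]; first by have [] := is_Cn_is_derive i Ca Ux.
split=> [x Ux|j]; first exact: is_C1_partial_continuous Ca Ux.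
split=> [x Ux|].
  have [rho rho0 [G HG]] := loc x Ux.
  have xr : nball x rho x by rewrite /nball /= subrr normr0.
  by have [[]] := HG i j x xr.
split=> // x Ux; have [rho rho0 [G HG]] := loc x Ux.
have xr : nball x rho x by rewrite /nball /= subrr normr0.
apply: (continuous_ext_open (U := nball x rho) (f := G i j)) => //.
- exact: open_nball.
- by move=> y yr; have [dg _ _] := HG i j y yr; rewrite (partialE dg).
- by case: (HG i j x xr).
Qed.

Lemma comb4_is_derive U (f1 f2 f3 f4 : R4 -> R) (v : R4) (k1 k2 k3 k4 d1 d2 d3 d4 : R) x :
  open U -> U x -> (forall y, U y -> k1 * f1 y + k2 * f2 y + (k3 * f3 y + k4 * f4 y) = 0) ->
  is_derive x v f1 d1 -> is_derive x v f2 d2 -> is_derive x v f3 d3 -> is_derive x v f4 d4 ->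
  k1 * d1 + k2 * d2 + (k3 * d3 + k4 * d4) = 0.
Proof.
move=> oU Ux E h1 h2 h3 h4.
have h := is_deriveD (is_derive_comb2 k1 k2 h1 h2) (is_derive_comb2 k3 k4 h3 h4).
have {}h := is_derive_ext (g := fun=> 0) oU E Ux h.
by rewrite -(@derive_val _ _ _ _ _ _ _ h) derive_cst.
Qed.

(** [CR_conj] followed by multiplication by [(- i) ^ 3 = i], which brings [d] into first place. *)
Lemma CR_conj_mulNi U a b c d : open U -> CR_system U a b c d ->
  CR_system U d c (fun x => - b x) (fun x => - a x).
Proof.
move=> oU S; have := CR_mulNi oU (CR_mulNi oU (CR_mulNi oU (CR_conj oU S))).
have NN f : (fun x => - - f x) = f :> (R4 -> R) by apply/funext => y; rewrite opprK.
by rewrite (NN d) (NN c) (NN (fun x => - a x)).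
Qed.

(** The combination of equations used for the averages now applies to [a] itself; second derivatives
    of [b], [c], [d] and their symmetry come from the rotated systems. *)
Lemma CR_laplacian U a b c d x : open U -> CR_system U a b c d -> U x ->
  \sum_i partial i (partial i a) x = 0.
Proof.
move=> oU S Ux; have [_ eqs] := S.
have Sb := CR_mulNi oU S; have Sc := CR_conj oU S.
have Sd := CR_conj_mulNi oU S.
have [Ca sa] := CR_C2 oU S; have [Cb sb] := CR_C2 oU Sb.
have [Cc sc] := CR_C2 oU Sc; have [Cd sd] := CR_C2 oU Sd.
have dd i j f : is_Cn 2 U f ->
    is_derive x (evec i) (partial j f) (partial i (partial j f) x).
  by move=> Cf; exact: is_Cn_is_derive (is_Cn_partial j Cf) Ux.
have e2 : 1 * partial 2 (partial 2 a) x + (-1) * partial 2 (partial 3 b) x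
   + (1 * partial 2 (partial 0 c) x + (-1) * partial 2 (partial 1 d) x) = 0.
  apply: (comb4_is_derive oU Ux _ (dd 2 2 a Ca) (dd 2 3 b Cb) (dd 2 0 c Cc) (dd 2 1 d Cd)).
  by move=> y /eqs[<- _ _ _]; ring.
have e3 : 1 * partial 3 (partial 2 b) x + 1 * partial 3 (partial 3 a) x
   + (1 * partial 3 (partial 0 d) x + 1 * partial 3 (partial 1 c) x) = 0.
  apply: (comb4_is_derive oU Ux _ (dd 3 2 b Cb) (dd 3 3 a Ca) (dd 3 0 d Cd) (dd 3 1 c Cc)).
  by move=> y /eqs[_ <- _ _]; ring.
have e0 : 1 * partial 0 (partial 0 a) x + 1 * partial 0 (partial 1 b) x
   + ((-1) * partial 0 (partial 2 c) x + (-1) * partial 0 (partial 3 d) x) = 0.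
  apply: (comb4_is_derive oU Ux _ (dd 0 0 a Ca) (dd 0 1 b Cb) (dd 0 2 c Cc) (dd 0 3 d Cd)).
  by move=> y /eqs[_ _ <- _]; ring.
have e1 : 1 * partial 1 (partial 0 b) x + (-1) * partial 1 (partial 1 a) x
   + ((-1) * partial 1 (partial 2 d) x + 1 * partial 1 (partial 3 c) x) = 0.
  apply: (comb4_is_derive oU Ux _ (dd 1 0 b Cb) (dd 1 1 a Ca) (dd 1 2 d Cd) (dd 1 3 c Cc)).
  by move=> y /eqs[_ _ _ <-]; ring.
rewrite (sb x Ux 3 2) (sb x Ux 1 0) (sc x Ux 2 0) (sc x Ux 3 1) in e0 e1 e2 e3.
rewrite (sd x Ux 2 1) (sd x Ux 3 0) in e0 e1 e2 e3.
rewrite sum_ord4; clear -e0 e1 e2 e3.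
pose H i j (f : R4 -> R) := partial i (partial j f) x.
rewrite -!/(H _ _ _) in e0 e1 e2 e3 *; clearbody H; move: e0 e1 e2 e3.
move: (H 0 0 a) (H 1 1 a) (H 2 2 a) (H 3 3 a) => a0 a1 a2 a3.
move: (H 2 3 b) (H 0 1 b) (H 0 2 c) (H 1 3 c) (H 1 2 d) (H 0 3 d) => b1 b2 c1 c2 d1 d2.
lra.
Qed.

End CauchyRiemannRegularity.

(** * The operators [L_j] *)

Section ComplexCalculus.
Variable R : realType.
Local Notation R4 := 'rV[R]_4.
Local Notation C := R[i].
Local Notation evec := (@evec R).
Implicit Types (U : set R4) (f g : R4 -> C).

Lemma ReM (z w : C) : complex.Re (z * w) =
  complex.Re z * complex.Re w - complex.Im z * complex.Im w.
Proof. by case: z w => a b [c d]. Qed.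

Lemma ImM (z w : C) : complex.Im (z * w) =
  complex.Re z * complex.Im w + complex.Im z * complex.Re w.
Proof. by case: z w => a b [c d]. Qed.

Lemma ReD (z w : C) : complex.Re (z + w) = complex.Re z + complex.Re w.
Proof. by case: z w => a b [c d]. Qed.

Lemma ImD (z w : C) : complex.Im (z + w) = complex.Im z + complex.Im w.
Proof. by case: z w => a b [c d]. Qed.

Lemma complex_ext (z w : C) : complex.Re z = complex.Re w -> complex.Im z = complex.Im w ->
  z = w.
Proof. by case: z w => a b [c d] /= -> ->. Qed.

Lemma is_CnCD n U f g : open U -> is_CnC n U f -> is_CnC n U g ->
  is_CnC n U (fun x => f x + g x).
Proof.
move=> oU [f1 f2] [g1 g2]; split.
  by apply: is_Cn_ext oU _ (is_CnD oU f1 g1) => x _; rewrite ReD.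
by apply: is_Cn_ext oU _ (is_CnD oU f2 g2) => x _; rewrite ImD.
Qed.

Lemma is_CnCM n U f g : open U -> is_CnC n U f -> is_CnC n U g ->
  is_CnC n U (fun x => f x * g x).
Proof.
move=> oU [f1 f2] [g1 g2]; split.
  apply: is_Cn_ext oU _ (is_CnD oU (is_CnM oU f1 g1) (is_CnN oU (is_CnM oU f2 g2))) => x _.
  by rewrite ReM.
apply: is_Cn_ext oU _ (is_CnD oU (is_CnM oU f1 g2) (is_CnM oU f2 g1)) => x _.
by rewrite ImM.
Qed.

Lemma is_CnC_partial n U f i : is_CnC n.+1 U f -> is_CnC n U (partialC i f).
Proof. by case=> h1 h2; split; exact: is_Cn_partial. Qed.

Lemma is_CnC_pred n U f : is_CnC n.+1 U f -> is_CnC n U f.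
Proof. by case=> h1 h2; split; exact: is_Cn_pred. Qed.

Lemma partialC_ext U f g i x : open U -> (forall y, U y -> f y = g y) -> U x ->
  partialC i f x = partialC i g x.
Proof.
by move=> oU fg Ux; rewrite /partialC; congr (_ +i* _)%C;
  apply: (partial_ext _ oU) => // y /fg ->.
Qed.

Lemma partialCD n U f g i x : is_CnC n.+1 U f -> is_CnC n.+1 U g -> U x ->
  partialC i (fun y => f y + g y) x = partialC i f x + partialC i g x.
Proof.
move=> [f1 f2] [g1 g2] Ux; apply: complex_ext; rewrite ?ReD ?ImD /=; apply: partialE.
  under [X in is_derive _ _ X]eq_fun do rewrite ReD.
  exact: (is_deriveD (is_Cn_is_derive i f1 Ux) (is_Cn_is_derive i g1 Ux)).
under [X in is_derive _ _ X]eq_fun do rewrite ImD.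
exact: (is_deriveD (is_Cn_is_derive i f2 Ux) (is_Cn_is_derive i g2 Ux)).
Qed.

Lemma partialCM n U f g i x : is_CnC n.+1 U f -> is_CnC n.+1 U g -> U x ->
  partialC i (fun y => f y * g y) x = partialC i f x * g x + f x * partialC i g x.
Proof.
move=> [f1 f2] [g1 g2] Ux.
have D1 := is_Cn_is_derive i f1 Ux; have D2 := is_Cn_is_derive i f2 Ux.
have E1 := is_Cn_is_derive i g1 Ux; have E2 := is_Cn_is_derive i g2 Ux.
apply: complex_ext; rewrite ?ReD ?ImD ?ReM ?ImM /=; apply: partialE.
  under [X in is_derive _ _ X]eq_fun do rewrite ReM.
  apply: (is_derive_eq (is_deriveB (is_deriveM D1 E1) (is_deriveM D2 E2))).
  by rewrite /GRing.scale /=; ring.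
under [X in is_derive _ _ X]eq_fun do rewrite ImM.
apply: (is_derive_eq (is_deriveD (is_deriveM D1 E2) (is_deriveM D2 E1))).
by rewrite /GRing.scale /=; ring.
Qed.

Lemma partialC_cst (k : C) i x : partialC i (fun=> k) x = 0.
Proof. by apply: complex_ext; rewrite /= /partial derive_cst. Qed.

Definition zgrad (A A' : 'I_2) (i : 'I_4) : C :=
  if A == 0 then
    if A' == 0 then ((2 == i)%:R +i* (3 == i)%:R)%C
    else ((0 == i)%:R +i* (1 == i)%:R)%C
  else
    if A' == 0 then (- (0 == i)%:R +i* (1 == i)%:R)%C
    else ((2 == i)%:R +i* (- (3 == i)%:R))%C.

Lemma zfunE (A A' : 'I_2) (x : R4) : zfun A A' x =
  if A == 0 then
    if A' == 0 then (x 0 2 +i* x 0 3)%C else (x 0 0 +i* x 0 1)%C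
  else
    if A' == 0 then (- x 0 0 +i* x 0 1)%C else (x 0 2 +i* (- x 0 3))%C.
Proof.
by rewrite /zfun; case: ifP => _; case: ifP => _; apply: complex_ext;
  rewrite /= ?mulr0 ?mulr1 ?mul0r ?subr0 ?oppr0 ?addr0 ?add0r.
Qed.

Lemma partialC_zfun i A A' x : partialC i (@zfun R A A') x = zgrad A A' i.
Proof.
rewrite /partialC (funext (@zfunE A A')) /zgrad.
have dN j : is_derive x (evec i) (fun y : R4 => - y 0 j) (- (j == i)%:R).
  exact: (is_deriveN (is_derive_coord x i j)).
by case: ifP => _; case: ifP => _; congr (_ +i* _)%C; apply: partialE => //;
  exact: is_derive_coord.
Qed.

Lemma is_CnC_zfun n U A A' : open U -> is_CnC n U (@zfun R A A').
Proof.
move=> oU; rewrite /is_CnC (funext (@zfunE A A')).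
by split; case: (A == 0); case: (A' == 0) => /=; try apply: is_CnN => //; exact: is_Cn_coord.
Qed.

Lemma sum_ord2 (V : nmodType) (F : 'I_2 -> V) : \sum_i F i = F 0 + F 1.
Proof.
rewrite !big_ord_recr big_ord0 /= add0r.
by congr (F _ + F _); apply: val_inj.
Qed.

Lemma ord2_cases (A : 'I_2) : A = 0 \/ A = 1.
Proof.
by case: A => [[|[|m]] h] //; [left|right]; apply: val_inj.
Qed.

Lemma nablaD n U A A' f g x : is_CnC n.+1 U f -> is_CnC n.+1 U g -> U x ->
  nabla A A' (fun y => f y + g y) x = nabla A A' f x + nabla A A' g x.
Proof.
move=> Cf Cg Ux; rewrite /nabla !(partialCD _ Cf Cg Ux).
move: (partialC 0 f x) (partialC 1 f x) (partialC 2 f x) (partialC 3 f x) => f0 f1 f2 f3.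
move: (partialC 0 g x) (partialC 1 g x) (partialC 2 g x) (partialC 3 g x) => g0 g1 g2 g3.
by case: ifP => _; case: ifP => _; ring.
Qed.

Lemma nablaM n U A A' f g x : is_CnC n.+1 U f -> is_CnC n.+1 U g -> U x ->
  nabla A A' (fun y => f y * g y) x = nabla A A' f x * g x + f x * nabla A A' g x.
Proof.
move=> Cf Cg Ux; rewrite /nabla !(partialCM _ Cf Cg Ux).
move: (partialC 0 f x) (partialC 1 f x) (partialC 2 f x) (partialC 3 f x) => f0 f1 f2 f3.
move: (partialC 0 g x) (partialC 1 g x) (partialC 2 g x) (partialC 3 g x) => g0 g1 g2 g3.
by case: ifP => _; case: ifP => _; ring.
Qed.

Lemma nabla_ext U A A' f g x : open U -> (forall y, U y -> f y = g y) -> U x ->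
  nabla A A' f x = nabla A A' g x.
Proof. by move=> oU fg Ux; rewrite /nabla !(partialC_ext _ oU fg Ux). Qed.

(** This is the antisymmetry of [nabla_A^B z_j^A'] in the primed indices when they coincide;
    [nabla_zfun_skew] is the case of distinct ones. *)
Lemma nabla_zfun_diag A A' j x : nabla A A' (@zfun R j A') x = 0.
Proof.
rewrite /nabla !partialC_zfun /zgrad.
by case: (ord2_cases A) => ->; case: (ord2_cases A') => ->; case: (ord2_cases j) => -> /=;
  apply: complex_ext => /=; ring.
Qed.

Lemma nabla_zfun_skew A j x :
  nabla A 0 (@zfun R j 1) x = - nabla A 1 (@zfun R j 0) x.
Proof.
rewrite /nabla !partialC_zfun /zgrad.
by case: (ord2_cases A) => ->; case: (ord2_cases j) => -> /=;
  apply: complex_ext => /=; ring.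
Qed.

(** Term by term, [nabla A A'] is minus the derivative along the constant complex vector
    [zgrad A A']. *)
Lemma sum_zgrad (A : 'I_2) f g x :
  \sum_(i < 4) zgrad A 0 i * partialC i f x + \sum_(i < 4) zgrad A 1 i * partialC i g x =
  - (nabla A 0 f x + nabla A 1 g x).
Proof.
rewrite !sum_ord4 /nabla /zgrad.
move: (partialC 0 f x) (partialC 1 f x) (partialC 2 f x) (partialC 3 f x) => f0 f1 f2 f3.
move: (partialC 0 g x) (partialC 1 g x) (partialC 2 g x) (partialC 3 g x) => g0 g1 g2 g3.
case: f0 f1 f2 f3 g0 g1 g2 g3 => [a0 b0] [a1 b1] [a2 b2] [a3 b3] [c0 d0] [c1 d1] [c2 d2] [c3 d3].
by case: (ord2_cases A) => -> /=; apply: complex_ext => /=; ring.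
Qed.

End ComplexCalculus.

(** * Regularity of [Lop j f] *)

Section KRegular.
Variable R : realType.
Local Notation R4 := 'rV[R]_4.
Local Notation C := R[i].
Implicit Types (U : set R4).

(** Permuting the indices of [Lop j f] amounts to permuting those of [f] with the contracted first
    index fixed. *)
Lemma tuple_cons_perm k (A : 'I_2) (t : k.-tuple 'I_2) (s : 'S_k) :
  [tuple of A :: [tuple tnth t (s i) | i < k]] =
  [tuple tnth [tuple of A :: t] (lift_perm ord0 ord0 s i) | i < k.+1].
Proof.
apply: eq_from_tnth => i; rewrite tnth_mktuple.
have [j ->|->] := unliftP ord0 i.
  by rewrite lift_perm_lift !tnthS tnth_mktuple.
by rewrite lift_perm_id !tnth0.
Qed.

Lemma sym_array_swap k (a : array R k.+2) (A B : 'I_2) (t : k.-tuple 'I_2) : sym_array a ->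
  a [tuple of A :: [tuple of B :: t]] = a [tuple of B :: [tuple of A :: t]].
Proof.
move=> sa; rewrite -(sa (tperm ord0 (lift ord0 ord0)) [tuple of B :: [tuple of A :: t]]).
congr (a _); apply: eq_from_tnth => i; rewrite tnth_mktuple.
case: tpermP => [->|->|/eqP i0 /eqP i1]; rewrite ?tnth0 ?tnthS ?tnth0 //.
have [j ij|ij] := unliftP ord0 i; last by rewrite ij eqxx in i0.
rewrite ij in i1 *; have [l jl|jl] := unliftP ord0 j; last by rewrite jl eqxx in i1.
by rewrite jl !tnthS.
Qed.

Lemma sym_arrayD k (a b : array R k) : sym_array a -> sym_array b -> sym_array (a + b).
Proof. by move=> sa sb s t; rewrite !ffunE sa sb. Qed.

Lemma is_harmonicD U (f g : R4 -> C) : open U -> is_harmonic U f -> is_harmonic U g ->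
  is_harmonic U (fun x => f x + g x).
Proof.
move=> oU [Cf hf] [Cg hg]; split; first exact: is_CnCD.
move=> x Ux; transitivity (\sum_i partialC i (partialC i f) x + \sum_i partialC i (partialC i g) x).
  rewrite -big_split; apply: eq_bigr => i _ /=.
  rewrite (partialC_ext i oU (f := partialC i (fun x => f x + g x))
    (g := fun y => partialC i f y + partialC i g y)) //; last first.
    by move=> y Uy; exact: partialCD Cf Cg Uy.
  exact: (partialCD i (is_CnC_partial i Cf) (is_CnC_partial i Cg) Ux).
exact: (etrans (congr2 +%R (hf x Ux) (hg x Ux)) (addr0 0)).
Qed.

Lemma cauchy_fueter_eq0 k (f : R4 -> array R k.+1) A x :
  cauchy_fueter f A x = 0 <-> forall t : k.-tuple 'I_2, nabla A 0 (fun y => f y [tuple of 0 :: t]) x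
    + nabla A 1 (fun y => f y [tuple of 1 :: t]) x = 0.
Proof.
split=> [/ffunP H t|H]; first by have := H t; rewrite !ffunE sum_ord2.
by apply/ffunP => t; rewrite !ffunE sum_ord2.
Qed.

Lemma k_regularD k U (f g : R4 -> array R k) : open U ->
  k_regular U f -> k_regular U g -> k_regular U (f \+ g).
Proof.
move=> oU; case: k f g => [|k] f g /=.
  move=> hf hg; have := is_harmonicD oU hf hg.
  by congr (is_harmonic U _); apply/funext => x; rewrite ffunE.
move=> [sf Cf Df] [sg Cg Dg].
have addE t : (fun x => (f x + g x) t) = (fun x => f x t + g x t).
  by apply/funext => x; rewrite ffunE.
split=> [x Ux|t|A x Ux].
- by apply: sym_arrayD; [exact: sf|exact: sg].
- by rewrite addE; exact: is_CnCD.
apply/cauchy_fueter_eq0 => t; rewrite !addE !(nablaD _ _ (Cf _) (Cg _) Ux) addrACA.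
have /cauchy_fueter_eq0 df := Df A x Ux; have /cauchy_fueter_eq0 dg := Dg A x Ux.
by rewrite [X in X + _]df [X in _ + X]dg addr0.
Qed.

Lemma LopE k j (f : R4 -> array R k.+1) x t : Lop j f x t =
  zfun j 0 x * f x [tuple of 0 :: t] + zfun j 1 x * f x [tuple of 1 :: t].
Proof. by rewrite ffunE sum_ord2. Qed.

(** The equation for [A = 0] gives the first two real equations up to sign, the one for [A = 1] the
    last two. *)
Lemma k_regular_CR U (f : R4 -> array R 1) : k_regular U f ->
  CR_system U (fun x => complex.Re (f x [tuple 0])) (fun x => complex.Im (f x [tuple 0]))
    (fun x => complex.Re (f x [tuple 1])) (fun x => complex.Im (f x [tuple 1])).
Proof.
move=> [_ Cf Df]; have [C0 C0'] := Cf [tuple 0]; have [C1 C1'] := Cf [tuple 1].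
split=> // x Ux.
have tE (A' : 'I_2) : [tuple of A' :: [tuple]] = [tuple A'] by apply: val_inj.
have E A : nabla A 0 (fun y => f y [tuple 0]) x + nabla A 1 (fun y => f y [tuple 1]) x = 0.
  by have /cauchy_fueter_eq0/(_ [tuple]) := Df A x Ux; rewrite !tE.
have := E 0; have := E 1; rewrite /nabla /partialC /=.
set a := fun y => complex.Re (f y [tuple 0]); set b := fun y => complex.Im (f y [tuple 0]).
set c := fun y => complex.Re (f y [tuple 1]); set d := fun y => complex.Im (f y [tuple 1]).
pose p i g : R := partial i g x; rewrite -!/(p _ _).
move: (p 0 a) (p 1 a) (p 2 a) (p 3 a) => a0 a1 a2 a3.
move: (p 0 b) (p 1 b) (p 2 b) (p 3 b) => b0 b1 b2 b3.
move: (p 0 c) (p 1 c) (p 2 c) (p 3 c) => c0 c1 c2 c3.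
move: (p 0 d) (p 1 d) (p 2 d) (p 3 d) => d0 d1 d2 d3.
clear; move=> [e3 e4] [e1 e2].
by split; lra.
Qed.

(** [CR_C2] and [CR_laplacian] speak of the first component of a system; the three rotated systems
    [Sb], [Sc], [Sd] treat the others. *)
Lemma one_regular_harmonic U (f : R4 -> array R 1) t : open U -> k_regular U f ->
  is_harmonic U (fun x => f x t).
Proof.
move=> oU /k_regular_CR S.
have h (a b : R4 -> R) : is_Cn 2 U a -> is_Cn 2 U b ->
   (forall x, U x -> \sum_i partial i (partial i a) x = 0) ->
   (forall x, U x -> \sum_i partial i (partial i b) x = 0) ->
   is_harmonic U (fun x => (a x +i* b x)%C).
  move=> Ca Cb la lb; split; first by split; [exact: Ca|exact: Cb].
  move=> x Ux; apply: complex_ext; rewrite /= ?raddf_sum /=.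
    by rewrite -[RHS](la x Ux) !sum_ord4.
  by rewrite -[RHS](lb x Ux) !sum_ord4.
have Sb := CR_mulNi oU S; have Sc := CR_conj oU S.
have Sd := CR_conj_mulNi oU S.
have [A' ->] : exists A', t = [tuple A'].
  by case/tupleP: t => A' s; exists A'; apply: val_inj; rewrite /= (tuple0 s).
case: (ord2_cases A') => ->.
  have -> : (fun x => f x [tuple 0]) =
      (fun x => (complex.Re (f x [tuple 0]) +i* complex.Im (f x [tuple 0]))%C).
    by apply/funext => x; case: (f x _).
  apply: h; [exact: (CR_C2 oU S).1|exact: (CR_C2 oU Sb).1|..].
  - by move=> x; exact: CR_laplacian S.
  - by move=> x; exact: CR_laplacian Sb.
have -> : (fun x => f x [tuple 1]) =
    (fun x => (complex.Re (f x [tuple 1]) +i* complex.Im (f x [tuple 1]))%C).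
  by apply/funext => x; case: (f x _).
apply: h; [exact: (CR_C2 oU Sc).1|exact: (CR_C2 oU Sd).1|..].
- by move=> x; exact: CR_laplacian Sc.
- by move=> x; exact: CR_laplacian Sd.
Qed.

(** The Leibniz rule is applied twice; [zfun j A'] is linear, so its second derivatives drop out. *)
Lemma partialC2_zfunM U j A' (f : R4 -> C) i x : open U -> is_CnC 2 U f -> U x ->
  partialC i (partialC i (fun y => zfun j A' y * f y)) x =
  2 * (zgrad R j A' i * partialC i f x) + zfun j A' x * partialC i (partialC i f) x.
Proof.
move=> oU Cf Ux.
have Cz n : is_CnC n U (@zfun R j A') by exact: is_CnC_zfun.
have Cc n : is_CnC n U (fun=> zgrad R j A' i) by split; exact: is_Cn_cst.
have Cp := is_CnC_partial i Cf.
rewrite (partialC_ext i oU (f := partialC i (fun y => zfun j A' y * f y))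
  (g := fun y => zgrad R j A' i * f y + zfun j A' y * partialC i f y)) //; last first.
  by move=> y Uy; rewrite (partialCM i (Cz 2) Cf Uy) partialC_zfun.
rewrite (partialCD i (n := 0) _ _ Ux).
- rewrite (partialCM i (Cc 1%N) (is_CnC_pred Cf) Ux) (partialCM i (Cz 1%N) Cp Ux).
  rewrite partialC_cst partialC_zfun; move: (zgrad R j A' i) (partialC i f x) => u v.
  by move: (zfun j A' x) (partialC i (partialC i f) x) => z w; ring.
- exact: (is_CnCM oU (Cc 1%N) (is_CnC_pred Cf)).
- exact: (is_CnCM oU (Cz 1%N) Cp).
Qed.

Lemma k_regular_Lop k U j (f : R4 -> array R k.+1) : open U ->
  k_regular U f -> k_regular U (Lop j f).
Proof.
move=> oU; case: k f => [|k] f hf.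
  have H t := one_regular_harmonic t oU hf.
  have [_ _ Df] := hf.
  rewrite /=; under eq_fun do rewrite LopE.
  set t0 := [tuple of 0 :: _]; set t1 := [tuple of 1 :: _].
  have [C0 L0] := H t0; have [C1 L1] := H t1.
  have Cz A' : is_CnC 2 U (@zfun R j A') by exact: is_CnC_zfun.
  have M0 := is_CnCM oU (Cz 0) C0; have M1 := is_CnCM oU (Cz 1) C1.
  split; first exact: is_CnCD.
  move=> x Ux.
  have E i : partialC i (partialC i (fun y => zfun j 0 y * f y t0 + zfun j 1 y * f y t1)) x =
    2 * (zgrad R j 0 i * partialC i (fun y => f y t0) x
         + zgrad R j 1 i * partialC i (fun y => f y t1) x)
    + (zfun j 0 x * partialC i (partialC i (fun y => f y t0)) x
       + zfun j 1 x * partialC i (partialC i (fun y => f y t1)) x).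
    rewrite (partialC_ext i oU
      (f := partialC i (fun y => zfun j 0 y * f y t0 + zfun j 1 y * f y t1))
      (g := fun y => partialC i (fun y => zfun j 0 y * f y t0) y
         + partialC i (fun y => zfun j 1 y * f y t1) y)) //; last first.
      by move=> y Uy; exact: (partialCD i M0 M1 Uy).
    rewrite (partialCD i (is_CnC_partial i M0) (is_CnC_partial i M1) Ux).
    rewrite (partialC2_zfunM j 0 i oU C0 Ux) (partialC2_zfunM j 1 i oU C1 Ux).
    by rewrite mulrDr addrACA.
  have comb (u v p q : 'I_4 -> C) z0 z1 : \sum_i u i + \sum_i v i = 0 ->
      \sum_i p i = 0 -> \sum_i q i = 0 ->
      \sum_i (2 * (u i + v i) + (z0 * p i + z1 * q i)) = 0.
    move=> uv p0 q0; rewrite big_split /= -mulr_sumr !big_split /= uv -!mulr_sumr p0 q0.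
    by rewrite !mulr0 !addr0.
  rewrite (eq_bigr _ (fun i _ => E i)); apply: comb; [|exact: L0|exact: L1].
  (* The index [j] of [z] takes the place of the unprimed index: the gradient terms are minus the
     component [j] of the equation for [f]. *)
  rewrite (sum_zgrad j (fun y => f y t0) (fun y => f y t1)).
  have /cauchy_fueter_eq0/(_ [tuple]) -> := Df j x Ux.
  exact: oppr0.
have [sf Cf Df] := hf.
have LE t : (fun x => Lop j f x t) = (fun x =>
    zfun j 0 x * f x [tuple of 0 :: t] + zfun j 1 x * f x [tuple of 1 :: t]).
  by apply/funext => x; exact: LopE.
have Cz A' : is_CnC 1 U (@zfun R j A') by exact: is_CnC_zfun.
split=> [x Ux s t|t|A x Ux].
- by rewrite !LopE !tuple_cons_perm !(sf x Ux).
- by rewrite LE; apply: (is_CnCD oU (is_CnCM oU (Cz 0) (Cf _)) (is_CnCM oU (Cz 1) (Cf _))).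
apply/cauchy_fueter_eq0 => t; rewrite !LE.
have CM A' t' : is_CnC 1 U (fun y => zfun j A' y * f y t') by exact: is_CnCM.
rewrite !(nablaD _ _ (CM _ _) (CM _ _) Ux) !(nablaM _ _ (Cz _) (Cf _) Ux).
have D A' : nabla A 0 (fun y => f y [tuple of 0 :: [tuple of A' :: t]]) x
    + nabla A 1 (fun y => f y [tuple of 1 :: [tuple of A' :: t]]) x = 0.
  by have /cauchy_fueter_eq0 := Df A x Ux; exact.
(* The equation for [f] contracts [nabla] with the first index, which in [Lop j f] is taken by [z],
   leaving the second one to [nabla]; symmetry exchanges them. *)
have swap B : nabla A B (fun y => f y [tuple of 0 :: [tuple of 1 :: t]]) x =
    nabla A B (fun y => f y [tuple of 1 :: [tuple of 0 :: t]]) x.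
  by apply: (nabla_ext _ _ oU _ Ux) => y Uy; exact: sym_array_swap (sf y Uy).
have D0 := D 0; have D1 := D 1.
rewrite -swap in D0; rewrite swap in D1.
(* The derivatives of [z] leave [n * (f_01 - f_10)], with [n] the derivative of [z_j^0'] by
   [nabla A 1]; it vanishes by symmetry. *)
rewrite !nabla_zfun_diag nabla_zfun_skew (sym_array_swap 1 0 t (sf x Ux)).
move/eqP: D0; rewrite addr_eq0 => /eqP ->; move/eqP: D1; rewrite addr_eq0 => /eqP ->.
move: (nabla A 1 (@zfun R j 0) x) (zfun j 0 x) (zfun j 1 x) => n z0 z1.
move: (f x _) (f x _) (f x _) (nabla _ _ _ _) (nabla _ _ _ _) => u v w p q.
ring.
Qed.

End KRegular.

(** Since [j * j = -1], [tau u] is [j u_0 - u_1], and the four components of its [fueter] image are,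
    up to sign, the four equations of [CR_system]. *)
Lemma tau_regular (R : realType) (U : set 'rV[R]_4) (u : 'rV[R]_4 -> array R 1) :
  open U -> k_regular U u -> quat_regular U (tau u).
Proof.
move=> oU /k_regular_CR [[Ca Cb Cc Cd] eqs].
set a := fun x => complex.Re (u x [tuple 0]) in Ca eqs.
set b := fun x => complex.Im (u x [tuple 0]) in Cb eqs.
set c := fun x => complex.Re (u x [tuple 1]) in Cc eqs.
set d := fun x => complex.Im (u x [tuple 1]) in Cd eqs.
have -> : tau u = (fun x => Quat (- c x) (- d x) (a x) (- b x)).
  by apply/funext => x; rewrite /tau /quat_of_complex; congr Quat => /=; rewrite /a /b /c /d; ring.
split; first by split; [exact: is_CnN|exact: is_CnN|exact: Ca|exact: is_CnN].
move=> x Ux; have [e1 e2 e3 e4] := eqs x Ux.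
have pN i f : is_Cn 1 U f -> partial i (fun x => - f x) x = - partial i f x.
  by move=> Cf; apply: partialE; exact: (is_deriveN (is_Cn_is_derive i Cf Ux)).
rewrite /fueter /partialH /= !(pN _ _ Cb) !(pN _ _ Cc) !(pN _ _ Cd).
pose p i g : R := partial i g x; rewrite -!/(p _ _) in e1 e2 e3 e4 *.
move: e1 e2 e3 e4; clearbody p; clear Ca Cb Cc Cd eqs pN.
move: (p 0 a) (p 1 a) (p 2 a) (p 3 a) => a0 a1 a2 a3.
move: (p 0 b) (p 1 b) (p 2 b) (p 3 b) => b0 b1 b2 b3.
move: (p 0 c) (p 1 c) (p 2 c) (p 3 c) => c0 c1 c2 c3.
move: (p 0 d) (p 1 d) (p 2 d) (p 3 d) => d0 d1 d2 d3.
by clear => e1 e2 e3 e4; congr Quat => /=; lra.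
Qed.

Theorem theorem1p1 (R : realType) (Omega : set 'rV[R]_4)
    (hOmega : is_domain Omega) :
  (forall (k : nat) (f g : 'rV[R]_4 -> array R k.+1),
      k_regular Omega f -> k_regular Omega g ->
      k_regular Omega (Lop 0 f \+ Lop 1 g)) /\
  (forall f g : 'rV[R]_4 -> array R 2,
      k_regular Omega f -> k_regular Omega g ->
      quat_regular Omega (tau (Lop 0 f \+ Lop 1 g))) /\
  (forall f g : 'rV[R]_4 -> array R 1,
      k_regular Omega f -> k_regular Omega g ->
      is_harmonic Omega (fun x => (Lop 0 f \+ Lop 1 g) x [tuple])).
Proof.
have [oO _ _] := hOmega.
have main k (f g : 'rV[R]_4 -> array R k.+1) : k_regular Omega f -> k_regular Omega g ->
    k_regular Omega (Lop 0 f \+ Lop 1 g).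
  by move=> hf hg; apply: k_regularD => //; exact: k_regular_Lop.
split; first exact: main.
(* On [array 0], [k_regular] unfolds to harmonicity of the only entry, so the last claim is [main]
   at 0 by conversion. *)
split=> f g hf hg; last exact: (main 0%N f g hf hg).
by apply: tau_regular => //; exact: (main 1%N f g hf hg).
Qed.
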